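(* Let $\Omega\subset\mathbb{R}^N$ be a Friedrichs admissible domain with best Friedrichs constant $c_{\mathsf f}$. Let $$\mathring{L}:\mathring{\mathsf H}^2(\Omega)\subset\mathsf L^2(\Omega)\to\mathsf L^2(\Omega),\qquad\varphi\mapsto-\Delta\varphi .$$ Then $\mathring{L}$ is densely defined and closed, and its Hilbert space adjoint is $$L:=\mathring{L}^*:\mathsf H(\Delta,\Omega)\subset\mathsf L^2(\Omega)\to\mathsf L^2(\Omega),\qquad\varphi\mapsto-\Delta\varphi .$$ Both ranges are closed, and $$N(\mathring{L})=\{0\},\quad R(\mathring{L})=\mathsf L^2(\Omega)\cap\mathbb{H}^\perp,\quad N(L)=\mathbb{H},\quad R(L)=\mathsf L^2(\Omega).$$ The reduced operators $$\mathring{\mathcal L}:\mathring{\mathsf H}^2(\Omega)\to\mathsf L^2(\Omega)\cap\mathbb{H}^\perp,\qquad \mathcal L:\mathsf H(\Delta,\Omega)\cap\mathbb{H}^\perp\to\mathsf L^2(\Omega)$$ (both acting as $-\Delta$) are bijective with bounded inverses, and, as operators between $\mathsf L^2$-normed spaces, $$\|\mathring{\mathcal L}^{-1}\|=\|\mathcal L^{-1}\|\le c_{\mathsf f}^2 .$$ In particular, $\|\varphi\|_{\mathsf L^2(\Omega)}\le c_{\mathsf f}^2\|\Delta\varphi\|_{\mathsf L^2(\Omega)}$ for all $\varphi\in\mathring{\mathsf H}^2(\Omega)$ and all $\varphi\in\mathsf H(\Delta,\Omega)\cap\mathbb{H}^\perp$. Consequently, for each $f\in\mathsf L^2(\Omega)\cap\mathbb{H}^\perp$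 there is a unique $u\in\mathring{\mathsf H}^2(\Omega)$ with $-\Delta u=f$, and for each $f\in\mathsf L^2(\Omega)$ there is a unique $u\in\mathsf H(\Delta,\Omega)$ with $u\perp\mathbb{H}$ and $-\Delta u=f$.
   Context: A domain is a (nonempty) connected open set $\Omega\subset\mathbb{R}^N$, $N\in\mathbb{N}$; no regularity of the boundary is assumed. $\mathring{\mathsf H}^k(\Omega)$ is the closure of the compactly supported smooth functions in $\mathsf H^k(\Omega)$. $\Omega$ is called Friedrichs admissible if there is $c_{\mathsf f}>0$ with $\|\varphi\|_{\mathsf L^2(\Omega)}\le c_{\mathsf f}\|\nabla\varphi\|_{\mathsf L^2(\Omega)}$ for all $\varphi\in\mathring{\mathsf H}^1(\Omega)$; $c_{\mathsf f}$ denotes the best such constant. All differential operators are distributional, $\perp$ is orthogonality in $\mathsf L^2(\Omega)$, and $N(\cdot)$, $R(\cdot)$ denote kernel and range. $\mathsf H(\Delta,\Omega):=\{\varphi\in\mathsf L^2(\Omega):\Delta\varphi\in\mathsf L^2(\Omega)\}$, $\mathbb{H}:=\{\varphi\in\mathsf L^2(\Omega):\Delta\varphi=0\}$. *)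

(* Defs.v *)
From HB Require Import structures.
From mathcomp Require Import all_boot all_order all_algebra.
From mathcomp Require Import all_classical all_reals all_analysis.
From mathcomp Require Import measurable_realfun.

Set Implicit Arguments.
Unset Strict Implicit.
Unset Printing Implicit Defensive.
Import Order.TTheory GRing.Theory Num.Theory.
Import numFieldNormedType.Exports.

Local Open Scope classical_set_scope.
Local Open Scope ring_scope.

(* 'rV[R]_N carries the sigma-algebra generated by the coordinate functions,
   which is the Borel one: see open_measurable_rV below. *)
Definition rV_coord (R : realType) (N : nat) (i : 'I_N) (x : 'rV[R]_N) : R :=
  x ord0 i.

Definition measure_rV_display : measure_display. Proof. exact. Qed.

Section measurable_rV.
Context {R : realType} (N : nat).

Let coords : 'I_N -> 'rV[R]_N -> R := fun i x => rV_coord i x.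

Let rV_set0 : g_sigma_preimage coords set0.
Proof. exact: sigma_algebra0. Qed.

Let rV_setC A : g_sigma_preimage coords A -> g_sigma_preimage coords (~` A).
Proof. exact: sigma_algebraC. Qed.

Let rV_bigcup (F : (set 'rV[R]_N)^nat) : (forall i, g_sigma_preimage coords (F i)) ->
  g_sigma_preimage coords (\bigcup_i (F i)).
Proof. exact: sigma_algebra_bigcup. Qed.

HB.instance Definition _ := @isMeasurable.Build measure_rV_display
  'rV[R]_N (g_sigma_preimage coords) rV_set0 rV_setC rV_bigcup.

End measurable_rV.

Lemma measurable_rV_coord (R : realType) N (i : 'I_N) :
  measurable_fun [set: 'rV[R]_N] (@rV_coord R N i).
Proof.
move=> _ Y mY; rewrite setTI; apply: sub_sigma_algebra => /=.
rewrite -bigcup_seq/=; exists i => /=; first by rewrite mem_index_enum.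
by exists Y => //; rewrite setTI.
Qed.

Lemma measurable_fun_rVP (R : realType) d (T : measurableType d) N
    (f : T -> 'rV[R]_N) :
  (forall i, measurable_fun setT (@rV_coord R N i \o f)) ->
  measurable_fun setT f.
Proof.
move=> mf; apply: (@measurability _ _ _ _ _ _
  (\big[setU/set0]_(i < N) preimage_set_system setT (@rV_coord R N i) measurable)) => //.
move=> _ [C + <-]; rewrite setTI.
rewrite -bigcup_seq/= => -[i _ [A mA <-]].
rewrite setTI; have := mf i measurableT A mA.
by rewrite setTI.
Qed.

(* An open set is the countable union of the cubes with rational centre and
   radius 1/(k+1) that it contains. *)
Lemma open_measurable_rV (R : realType) N (A : set 'rV[R]_N) :
  open A -> measurable A.
Proof.
move=> oA.
pose B (c : 'rV[rat]_N * nat) : set 'rV[R]_N :=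
  \bigcap_(i in [set: 'I_N]) ((@rV_coord R N i) @^-1` ball (ratr (c.1 ord0 i) : R) c.2.+1%:R^-1).
have mB c : measurable (B c).
  rewrite /B; apply: fin_bigcap_measurable => // i _.
  rewrite -[X in measurable X]setTI; apply: measurable_rV_coord => //.
  exact: measurable_ball.
rewrite (_ : A = \bigcup_(c in [set c | B c `<=` A]) B c); last first.
  apply/seteqP; split => [x Ax|x [c cA Bx]]; last exact: cA.
  have /nbhs_ballP[e /= e0 eA] : nbhs x A by move: oA; rewrite openE; exact.
  pose k := Num.truncn (2 / e).
  have ke : k.+1%:R^-1 < e / 2 :> R.
    rewrite -[ltRHS]invrK ltf_pV2 ?posrE ?invr_gt0 ?divr_gt0//.
    by rewrite invf_div truncnS_gt// divr_ge0// ltW.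
  have k0 : 0 < k.+1%:R^-1 :> R by rewrite invr_gt0.
  have /(_ _)/cid-/all_sig[q qP] : forall i : 'I_N, exists q : rat,
      `|rV_coord i x - ratr q| < k.+1%:R^-1.
    move=> i.
    have /rat_in_itvoo[q] : rV_coord i x < rV_coord i x + k.+1%:R^-1.
      by rewrite ltrDl.
    rewrite in_itv/= => /andP[q1 q2]; exists q.
    by rewrite distrC ger0_norm ?subr_ge0 1?ltW// ltrBlDl.
  exists (\row_i q i, k) => /=.
    move=> y Bxy; apply: eA.
    split => // i j; rewrite (ord1 i).
    have := Bxy j I; rewrite /= mxE /ball /= => yj.
    rewrite /ball/=.
    have := qP j; rewrite /rV_coord in yj *.
    move=> xj.
    rewrite (splitr e) (le_lt_trans (ler_distD (ratr (q j)) _ _))//.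
    by rewrite ltrD// (lt_trans _ ke).
  by move=> i _ /=; rewrite mxE /ball /= distrC.
rewrite bigcup_mkcond; apply: countable_bigcupT_measurable => [|c]; first exact: countableP.
by case: ifP => _; [exact: mB|exact: measurable0].
Qed.

Section rV_cons.
Context {R : realType} {N : nat}.

Definition rV_cons (x : measurableTypeR R * 'rV[R]_N) : 'rV[R]_N.+1 :=
  \row_i (if unlift ord0 i is Some j then x.2 ord0 j else x.1).

Lemma measurable_rV_cons : measurable_fun setT rV_cons.
Proof.
apply: measurable_fun_rVP => i.
rewrite (_ : _ \o _ = fun x : measurableTypeR R * 'rV[R]_N =>
  if unlift ord0 i is Some j then rV_coord j x.2 else x.1); last first.
  by apply/funext => x /=; rewrite /rV_coord mxE.
case: (unlift ord0 i) => [j|]; last exact: measurable_fst.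
by apply: (measurableT_comp (measurable_rV_coord j)); exact: measurable_snd.
Qed.

HB.instance Definition _ :=
  isMeasurableFun.Build _ _ _ _ rV_cons measurable_rV_cons.

End rV_cons.


Definition rV_uncons {R : realType} {N : nat} (x : 'rV[R]_N.+1) :
    measurableTypeR R * 'rV[R]_N :=
  (x ord0 ord0, \row_j x ord0 (lift ord0 j)).

Lemma rV_unconsK {R : realType} {N : nat} : cancel (@rV_uncons R N) rV_cons.
Proof.
move=> x; apply/rowP => i; rewrite mxE; case: unliftP => [j ->|->] //=.
by rewrite mxE.
Qed.

Lemma rV_consK {R : realType} {N : nat} : cancel (@rV_cons R N) rV_uncons.
Proof.
move=> [x y]; rewrite /rV_uncons mxE unlift_none; congr pair.
by apply/rowP => j; rewrite !mxE liftK.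
Qed.

Lemma measurable_rV_uncons {R : realType} {N : nat} :
  measurable_fun setT (@rV_uncons R N).
Proof.
apply/measurable_fun_pair; first exact: (measurable_rV_coord ord0).
apply: measurable_fun_rVP => j.
rewrite (_ : _ \o _ = rV_coord (lift ord0 j)); last first.
  by apply/funext => x /=; rewrite /rV_coord mxE.
exact: measurable_rV_coord.
Qed.

Section lebesgue_cons.
Context {R : realType} {N : nat}.
Variable mu : {sigma_finite_measure set 'rV[R]_N -> \bar R}.

Let nu : set 'rV[R]_N.+1 -> \bar R :=
  pushforward (@lebesgue_measure R \x mu)%E rV_cons.

Let mrV_cons := @measurable_rV_cons R N.

Let nu0 : nu set0 = 0%E. Proof. exact: measure0. Qed.

Let nu_ge0 A : (0 <= nu A)%E. Proof. exact: measure_ge0. Qed.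

Let nu_sigma_additive : semi_sigma_additive nu.
Proof. exact: measure_semi_sigma_additive. Qed.

HB.instance Definition _ := isMeasure.Build _ _ _ nu nu0 nu_ge0 nu_sigma_additive.

Let nu_sigma_finite : sigma_finite setT nu.
Proof.
have /sigma_finiteP[F [FT ndF F_oo]] := sigma_finiteT (@lebesgue_measure R).
have /sigma_finiteP[G [GT ndG G_oo]] := sigma_finiteT mu.
exists (fun n => rV_uncons @^-1` (F n `*` G n)) => [|n].
  rewrite -preimage_bigcup -(preimage_setT rV_uncons); congr (_ @^-1` _).
  apply/esym; rewrite -subTset => -[x y] _.
  have [n _ Fnx] : (\bigcup_i F i) x by rewrite -FT.
  have [k _ Gky] : (\bigcup_i G i) y by rewrite -GT.
  exists (maxn n k) => //; split.
  - by move: x Fnx; exact/subsetPset/ndF/leq_maxl.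
  - by move: y Gky; exact/subsetPset/ndG/leq_maxr.
have [mF Foo] := F_oo n; have [mG Goo] := G_oo n; split.
  rewrite -[X in measurable X]setTI; apply: measurable_rV_uncons => //.
  exact: measurableX.
rewrite /nu /pushforward -comp_preimage (_ : _ \o _ = id); last first.
  by apply/funext => x; exact: rV_consK.
by rewrite preimage_id product_measure1E// lte_mul_pinfty// ge0_fin_numE.
Qed.

HB.instance Definition _ :=
  Measure_isSigmaFinite.Build _ _ _ nu nu_sigma_finite.

Definition lebesgue_cons : {sigma_finite_measure set 'rV[R]_N.+1 -> \bar R} := nu.

End lebesgue_cons.

(* N-dimensional Lebesgue measure as an iterated product: R^(N+1) is identified
   with R * R^N by rV_cons. *)
Fixpoint lebesgue_rV (R : realType) (N : nat) :
    {sigma_finite_measure set 'rV[R]_N -> \bar R} :=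
  match N with
  | 0 => \d_(0 : 'rV[R]_0)
  | N'.+1 => lebesgue_cons (lebesgue_rV R N')
  end.

Section L2_theory.
Context {d : measure_display} {T : measurableType d} {R : realType}.
Variable mu : {measure set T -> \bar R}.

Local Notation Lf := (LfunType mu (lee1n 2)).

(* L2_space mu is the space of square-integrable functions modulo equality
   almost everywhere; an element coerces to a representative L2_fun. *)
Definition ae_zero : {pred Lf} := [pred f : Lf | `[< (f : T -> R) = cst 0 %[ae mu] >]].

Let ae_zero_zmod_closed : zmod_closed ae_zero.
Proof.
split => [|f g /asboolP f0 /asboolP g0]; apply/asboolP.
  by apply: nearW => x _.
apply: filterS2 f0 g0 => x f0 g0 xT.
have -> : (f - g : Lf) x = f x - g x by [].
by rewrite (f0 xT) (g0 xT) subrr.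
Qed.

HB.instance Definition _ := GRing.isZmodClosed.Build Lf ae_zero ae_zero_zmod_closed.

Definition L2_space : Type := Quotient.quot ae_zero.

HB.instance Definition _ := Choice.on L2_space.
HB.instance Definition _ := EqQuotient.on L2_space.
HB.instance Definition _ := ZmodQuotient.on L2_space.

Local Open Scope quotient_scope.

Definition L2_repr (u : L2_space) : Lf := repr u.
Definition L2_fun (u : L2_space) : T -> R := L2_repr u.
Coercion L2_fun : L2_space >-> Funclass.

Lemma L2_reprK (u : L2_space) : \pi_L2_space (L2_repr u) = u.
Proof. exact: reprK. Qed.

Lemma L2_pi_eqP (f g : Lf) : (f : T -> R) = g %[ae mu] <-> \pi_L2_space f = \pi_L2_space g.
Proof.
have fgE : (f - g \in ae_zero) = (\pi_L2_space f == \pi_L2_space g) by exact: Quotient.idealrBE.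
split=> [fg|/eqP].
  apply/eqP; rewrite -fgE; apply/asboolP; apply: filterS fg => x fg xT.
  by have -> : (f - g : Lf) x = f x - g x by []; rewrite (fg xT) subrr.
rewrite -fgE => /asboolP fg.
apply: filterS fg => x fg xT; apply/eqP; rewrite -subr_eq0; apply/eqP.
exact: (fg xT).
Qed.

Lemma L2_repr_pi (f : Lf) : (L2_repr (\pi_L2_space f) : T -> R) = f %[ae mu].
Proof. by apply/L2_pi_eqP; rewrite L2_reprK. Qed.

Let nm (f : Lf) : R := fine 'N[mu]_2[EFin \o f]%E.

Let nm_ae_zero (f : Lf) : (f : T -> R) = cst 0 %[ae mu] -> nm f = 0.
Proof.
move=> f0; rewrite /nm unlock (_ : \int[mu]_x _ = 0)%E.
  by rewrite poweR0r// invr_eq0.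
rewrite -(integral0 mu setT); apply: ae_eq_integral => //.
  apply/measurable_EFinP; apply: (@measurableT_comp _ _ _ _ _ _ (@powR R ^~ 2)) => //.
  exact: measurableT_comp.
by apply: filterS f0 => x /= f0 xT; rewrite (f0 xT) normr0 powR0// pnatr_eq0.
Qed.

Let nm_ae_eq (f g : Lf) : (f : T -> R) = g %[ae mu] -> nm f = nm g.
Proof.
suff le (h k : Lf) : (h : T -> R) = k %[ae mu] -> nm h <= nm k.
  by move=> fg; apply/eqP; rewrite eq_le !le//; exact: ae_eq_sym.
move=> hk; rewrite -[h](subrK k) (le_trans (ler_LnormD _ _))//.
rewrite [X in X + _](_ : _ = 0) ?add0r// -/(nm _) nm_ae_zero//.
apply: filterS hk => x hk xT.
by have -> : (h - k : Lf) x = h x - k x by []; rewrite (hk xT) subrr.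
Qed.

Definition L2_norm (u : L2_space) : R := fine 'N[mu]_2[EFin \o L2_fun u]%E.

Definition L2_scale (a : R) (u : L2_space) : L2_space := \pi_L2_space (a *: L2_repr u).

Let L2_piD (f g : Lf) : \pi_L2_space (f + g) = \pi_L2_space f + \pi_L2_space g :> L2_space.
Proof. exact: raddfD. Qed.

Let L2_piZ a (f : Lf) : \pi_L2_space (a *: f) = L2_scale a (\pi_L2_space f).
Proof.
apply/L2_pi_eqP; apply: filterS (L2_repr_pi f) => x fE xT.
have scaleE (h : Lf) : (a *: h) x = a * h x by [].
by rewrite !scaleE (fE xT).
Qed.

Let L2_scaleA a b u : L2_scale a (L2_scale b u) = L2_scale (a * b) u.
Proof. by rewrite -(L2_reprK u) -!L2_piZ scalerA. Qed.

Let L2_scale1 : left_id 1 L2_scale.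
Proof. by move=> u; rewrite -(L2_reprK u) -L2_piZ scale1r. Qed.

Let L2_scaleDr : right_distributive L2_scale +%R.
Proof.
by move=> a u v; rewrite -(L2_reprK u) -(L2_reprK v) -L2_piD -!L2_piZ scalerDr L2_piD.
Qed.

Let L2_scaleDl u : {morph L2_scale^~ u : a b / a + b}.
Proof. by move=> a b; rewrite -(L2_reprK u) -!L2_piZ scalerDl L2_piD. Qed.

HB.instance Definition _ := GRing.Zmodule_isLmodule.Build R L2_space
  L2_scaleA L2_scale1 L2_scaleDr L2_scaleDl.

Let L2_normE (f : Lf) : L2_norm (\pi_L2_space f) = nm f.
Proof. exact/nm_ae_eq/L2_repr_pi. Qed.

Let L2_normD u v : L2_norm (u + v) <= L2_norm u + L2_norm v.
Proof.
by rewrite -(L2_reprK u) -(L2_reprK v) -L2_piD !L2_normE; exact: ler_LnormD.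
Qed.

Let L2_normZ a u : L2_norm (a *: u) = `|a| * L2_norm u.
Proof.
rewrite -(L2_reprK u) [_ *: _](esym (L2_piZ _ _)) !L2_normE /nm.
by rewrite (LnormZ (L2_repr u) a) -finite_norm_fine.
Qed.

Let L2_norm_eq0 u : L2_norm u = 0 -> u = 0.
Proof.
rewrite -(L2_reprK u) L2_normE => /fine_Lnormr_eq0 u0.
by rewrite -(raddf0 \pi_L2_space); apply/L2_pi_eqP.
Qed.

HB.instance Definition _ := Lmodule_isNormed.Build R L2_space
  L2_normD L2_normZ L2_norm_eq0.

Definition L2_dot (u v : L2_space) : R := \int[mu]_x (u x * v x).

End L2_theory.

(* An unbounded operator x |-> op_app x on the domain op_dom; the values of
   op_app off the domain are irrelevant. *)
Record operator (E : Type) := Operator {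
  op_dom : set E;
  op_app :> E -> E }.

Section operators.
Context {R : realType} {E : normedModType R}.
Implicit Type T : operator E.

Definition op_linear T : Prop :=
  op_dom T 0 /\
  forall a x y, op_dom T x -> op_dom T y ->
    op_dom T (a *: x + y) /\ T (a *: x + y) = a *: T x + T y.

Definition op_graph T : set (E * E) := [set (x, T x) | x in op_dom T].

Definition op_ker T : set E := [set x | op_dom T x /\ T x = 0].

Definition op_range T : set E := T @` op_dom T.

Definition op_densely_defined T : Prop := dense (op_dom T).

Definition op_closed T : Prop := closed (op_graph T).

Definition op_restr T (A : set E) : operator E := Operator (op_dom T `&` A) T.

(* The inverse of an injective operator; its domain is the range of T. *)
Definition op_inv T : operator E :=
  Operator (op_range T) (fun y => xget 0 [set x | op_dom T x /\ T x = y]).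

Definition op_bounded T : Prop :=
  exists M : R, forall x, op_dom T x -> `|T x| <= M * `|x|.

Definition op_norm T : R :=
  sup [set `|T x| | x in op_dom T `&` [set x | `|x| <= 1]].

End operators.

Section L2_operators.
Context {d : measure_display} {X : measurableType d} {R : realType}.
Variable mu : {measure set X -> \bar R}.
Local Notation E := (L2_space mu).

Definition L2_ortho (A : set E) : set E :=
  [set u | forall v, A v -> L2_dot u v = 0].

(* z is the only such vector when T is densely defined. *)
Definition adjoint_rel (T : operator E) (y z : E) : Prop :=
  forall x, op_dom T x -> L2_dot (T x) y = L2_dot x z.

Definition op_adjoint (T : operator E) : operator E :=
  Operator [set y | exists z, adjoint_rel T y z]
           (fun y => xget 0 [set z | adjoint_rel T y z]).

End L2_operators.

Record domain (R : realType) (N : nat) := Domain {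
  dom_set :> set 'rV[R]_N;
  dom_open : open dom_set;
  dom_connected : connected dom_set;
  dom_nonempty : dom_set !=set0 }.
Arguments dom_open {R N} d.
Arguments dom_connected {R N} d.
Arguments dom_nonempty {R N} d.

(* Lebesgue measure restricted to Omega, as a measure on the whole space: the
   values of a function outside Omega are irrelevant for this measure. *)
Definition volume (R : realType) (N : nat) (Omega : domain R N) :
    {measure set 'rV[R]_N -> \bar R} :=
  mrestr (lebesgue_rV R N) (open_measurable_rV (dom_open Omega)).

Notation L2 Omega := (L2_space (volume Omega)).

Section test_functions.
Context {R : realType} {N : nat}.
Implicit Type f : 'rV[R]_N -> R.

Definition pderiv (i : 'I_N) f : 'rV[R]_N -> R :=
  fun x => 'D_(delta_mx ord0 i) f x.

Definition pderivs (s : seq 'I_N) f : 'rV[R]_N -> R := foldr pderiv f s.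

Definition smooth f : Prop := forall s : seq 'I_N,
  continuous (pderivs s f) /\
  forall i x, derivable (pderivs s f) x (delta_mx ord0 i).

Definition test_function (Omega : domain R N) f : Prop :=
  [/\ smooth f, compact (closure [set x | f x != 0]) &
      closure [set x | f x != 0] `<=` Omega].

Definition Delta f : 'rV[R]_N -> R := fun x => \sum_(i < N) pderivs [:: i; i] f x.

End test_functions.

Section sobolev.
Context {R : realType} {N : nat}.
Variable Omega : domain R N.
Local Notation vol := (volume Omega).

(* The elements of L^2(Omega) that have a representative in C^oo_c(Omega). *)
Definition test_class : set (L2 Omega) :=
  [set u | exists2 phi, test_function Omega phi & u = phi %[ae vol]].

Definition is_wderivs (s : seq 'I_N) (u v : L2 Omega) : Prop :=
  forall phi, test_function Omega phi ->
    \int[vol]_x (u x * pderivs s phi x) =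
    (-1) ^+ size s * \int[vol]_x (v x * phi x).

(* Weak derivatives are unique in L^2, so that xget picks the only one. *)
Definition wderivs (s : seq 'I_N) (u : L2 Omega) : L2 Omega :=
  xget 0 [set v | is_wderivs s u v].

Definition sobolev (k : nat) : set (L2 Omega) :=
  [set u | forall s : seq 'I_N, (size s <= k)%N -> exists v, is_wderivs s u v].

(* The sum is over sequences of directions instead of multi-indices, so that
   a mixed derivative is counted once per ordering; the norm is equivalent to
   the usual one. *)
Definition sobolev_norm (k : nat) (u : L2 Omega) : R :=
  Num.sqrt (\sum_(j < k.+1) \sum_(s : j.-tuple 'I_N) `|wderivs s u| ^+ 2).

Definition sobolev0 (k : nat) : set (L2 Omega) :=
  [set u | sobolev k u /\
    forall e, 0 < e -> exists2 phi, test_class phi & sobolev_norm k (u - phi) < e].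

Definition grad_norm (u : L2 Omega) : R :=
  Num.sqrt (\sum_(i < N) `|wderivs [:: i] u| ^+ 2).

Definition friedrichs_bound (c : R) : Prop :=
  forall phi, sobolev0 1 phi -> `|phi| <= c * grad_norm phi.

Definition friedrichs_admissible : Prop :=
  exists2 c, 0 < c & friedrichs_bound c.

Definition friedrichs_constant : R :=
  inf [set c | 0 < c /\ friedrichs_bound c].

(* v is the Laplacian of u in the sense of distributions; there is at most one
   such v in L^2(Omega). *)
Definition is_laplacian (u v : L2 Omega) : Prop :=
  forall phi, test_function Omega phi ->
    \int[vol]_x (u x * Delta phi x) = \int[vol]_x (v x * phi x).

Definition laplacian (u : L2 Omega) : L2 Omega :=
  xget 0 [set v | is_laplacian u v].

Definition H_Delta : set (L2 Omega) := [set u | exists v, is_laplacian u v].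

Definition L2_harmonic : set (L2 Omega) := [set u | is_laplacian u 0].

Definition laplace_min : operator (L2 Omega) :=
  Operator (sobolev0 2) (fun u => - laplacian u).

Definition laplace_max : operator (L2 Omega) :=
  Operator H_Delta (fun u => - laplacian u).

Definition laplace_red : operator (L2 Omega) :=
  op_restr laplace_max (L2_ortho L2_harmonic).

End sobolev.

Arguments test_class {R N} Omega.
Arguments sobolev {R N} Omega k.
Arguments sobolev0 {R N} Omega k.
Arguments H_Delta {R N} Omega.
Arguments L2_harmonic {R N} Omega.

(* Main.v *)
Require Import Defs.
From HB Require Import structures.
From mathcomp Require Import all_boot all_order all_algebra.
From mathcomp Require Import all_classical all_reals all_analysis.
From mathcomp Require Import measurable_realfun ring lra.
Import Order.TTheory GRing.Theory Num.Theory.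
Import numFieldNormedType.Exports.
Local Open Scope classical_set_scope.
Local Open Scope ring_scope.
Set Implicit Arguments.
Unset Strict Implicit.
Unset Printing Implicit Defensive.

(* The proof runs through the closure lap_graph of {(phi, Delta phi)}, phi a test
   function, in L^2 x L^2. Integrating by parts twice and commuting derivatives,
   sum_(i,j) |d_i d_j phi|^2 = |Delta phi|^2, and |grad phi|^2 = -<phi, Delta phi>
   together with the Friedrichs inequality bounds |grad phi| and |phi| by multiples
   of |Delta phi|; hence all weak derivatives of order at most 2 pass to the limit
   and lap_graph is the graph of Delta on sobolev0 2. The adjoint, the ranges and the
   kernels then follow from projections in L^2. For surjectivity of L, represent
   g |-> <L0^-1 g, f> on the closed range of L0 by Riesz. The two inverses have the
   same norm since <f, u> = <w, w> whenever L0 u = w and L w = f, and conversely.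

   Density of the test functions is dual: if u is orthogonal to all of them, the
   bumps prod_i h(n (x_i - a_i)) h(n (b_i - x_i)) with h(t) = exp(-1/t), which tend to
   the indicator of a box, show that u has integral 0 over small boxes. *)

(** No regularity of the boundary is available, nor any interior regularity of the elements of
    H(Delta). Integration by parts is therefore carried out only between two test functions, where
    it has no boundary term, and it reaches other elements of L^2 by limits in scalar products. The
    H^2 control behind [sobolev0 2] can be had because the Hessian identity concerns compactly
    supported functions only. The constant c^2 collects one factor c from |phi| <= c |grad phi| and
    one from |grad phi| <= c |Delta phi|, the latter a consequence of |grad phi|^2 <= |phi| |Delta
    phi|. [wderivs], [laplacian] and [op_adjoint] choose their values by [xget], so they can be
    computed only once uniqueness is known; this is the other use of the density of test functions.
    Smoothness is stated through iterated partial derivatives, so the symmetry of mixed derivatives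
    is derived from the mean value theorem. *)

Lemma eventually_invn_le (R : realType) (e : R) : 0 < e ->
  exists n0, forall n, (n0 <= n)%N -> (n.+1%:R^-1 : R) <= e.
Proof.
move=> e0; exists (Num.truncn e^-1) => n nn.
rewrite -[leRHS]invrK lef_pV2 ?posrE ?invr_gt0//.
by apply: le_trans (ltW (truncnS_gt _)) _; rewrite ler_nat ltnS.
Qed.

(** * The Hilbert space L^2 *)

Section L2_hilbert.
Local Open Scope quotient_scope.
Context {d : measure_display} {X : measurableType d} {R : realType}.
Variable mu : {measure set X -> \bar R}.
Local Notation E := (L2_space mu).
Implicit Types u v w : E.

Lemma L2_measurable u : measurable_fun setT u.
Proof. exact: measurable_funPT (L2_repr u). Qed.

Lemma L2_fun_Lfun u : (u : X -> R) \in Lfun mu 2%:E.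
Proof. exact: LfunP (L2_repr u). Qed.

Lemma L2_mul_integrable u v : mu.-integrable setT (EFin \o (fun x => u x * v x)).
Proof. by apply/Lfun1_integrable/Lfun2_mul_Lfun1; exact: L2_fun_Lfun. Qed.

Lemma L2_addE u v : L2_fun (u + v) = (fun x => u x + v x) %[ae mu].
Proof.
have -> : u + v = \pi_(L2_space mu) (L2_repr u + L2_repr v)%R.
  by rewrite raddfD; congr (_ + _); rewrite -[LHS]L2_reprK.
exact: L2_repr_pi.
Qed.

Lemma L2_scaleE (a : R) u : L2_fun (a *: u) = (fun x => a * u x) %[ae mu].
Proof. exact: (L2_repr_pi (a *: L2_repr u)). Qed.

Lemma L2_eqP u v : (u : X -> R) = v %[ae mu] <-> u = v.
Proof.
split=> [uv|->]; last exact: ae_eq_refl.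
by rewrite -(L2_reprK u) -(L2_reprK v); apply/L2_pi_eqP.
Qed.

Lemma L2_exists (f : X -> R) : f \in Lfun mu 2%:E ->
  exists u : E, (u : X -> R) = f %[ae mu].
Proof.
move=> f2; exists (\pi_(L2_space mu) (Lfun_Sub (lee1n 2) f2)).
have := L2_repr_pi (Lfun_Sub (lee1n 2) f2).
by rewrite Lfun_valP.
Qed.

Lemma sqr_integrable_Lfun (f : X -> R) : measurable_fun setT f ->
  (\int[mu]_x (f x ^+ 2)%:E < +oo)%E -> f \in Lfun mu 2%:E.
Proof.
move=> mf f2; rewrite inE; apply/andP; split; first by rewrite inE.
rewrite inE /= /finite_norm unlock.
rewrite (_ : (\int[mu]_x _)%E = (\int[mu]_x (f x ^+ 2)%:E)%E).
  by apply: poweR_lty.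
by apply: eq_integral => x _ /=; rewrite powR_mulrn// real_normK// num_real.
Qed.

Lemma L2_normsqE u : (`|u| ^+ 2)%:E = (\int[mu]_x (u x ^+ 2)%:E)%E.
Proof.
have -> : `|u| = fine 'N[mu]_2[EFin \o L2_fun u]%E by [].
rewrite -powR_mulrn ?fine_ge0 ?Lnorm_ge0// -poweR_EFin.
rewrite [X in (X `^ _)%E](finite_norm_fine (L2_repr u)).
rewrite powR_Lnorm//.
by apply: eq_integral => x _ /=; rewrite powR_mulrn// real_normK// num_real.
Qed.

Lemma L2_dot_norm u : L2_dot u u = `|u| ^+ 2.
Proof.
by rewrite /L2_dot /Rintegral -[RHS]/(fine (`|u| ^+ 2)%:E) L2_normsqE.
Qed.

Lemma L2_dotC u v : L2_dot u v = L2_dot v u.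
Proof. by apply: eq_Rintegral => x _; rewrite mulrC. Qed.

Lemma ae_eq_Rintegral (f g : X -> R) : measurable_fun setT f ->
  measurable_fun setT g -> f = g %[ae mu] ->
  \int[mu]_x f x = \int[mu]_x g x.
Proof.
move=> mf mg fg; congr fine; apply: ae_eq_integral => //; try exact/measurable_EFinP.
by apply: filterS fg => x fg xT; rewrite fg.
Qed.

Lemma L2_dotPl a u v w :
  L2_dot (a *: u + v) w = a * L2_dot u w + L2_dot v w.
Proof.
rewrite /L2_dot -RintegralZl//; last exact: L2_mul_integrable.
rewrite -RintegralD//; last 2 first.
- apply: eq_integrable (integrableZl measurableT a (L2_mul_integrable u w)) => //.
- exact: L2_mul_integrable.
have mu_ := L2_measurable.
apply: ae_eq_Rintegral; do ?[apply: measurable_funM|apply: measurable_funD] => //.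
have := L2_addE (a *: u) v; have := L2_scaleE a u.
by apply: filterS2 => x e1 e2 xT; rewrite e2// e1// mulrDl mulrA.
Qed.

Lemma L2_dotDl u v w : L2_dot (u + v) w = L2_dot u w + L2_dot v w.
Proof. by rewrite -[u]scale1r L2_dotPl mul1r scale1r. Qed.

Lemma L2_dot0l u : L2_dot 0 u = 0.
Proof. by have /(congr1 (+%R^~ (- L2_dot 0 u))) := L2_dotDl 0 0 u; rewrite addr0 subrr addrK => ->. Qed.

Lemma L2_dotZl a u v : L2_dot (a *: u) v = a * L2_dot u v.
Proof. by rewrite -[a *: u]addr0 L2_dotPl L2_dot0l addr0. Qed.

Lemma L2_dotNl u v : L2_dot (- u) v = - L2_dot u v.
Proof. by rewrite -scaleN1r L2_dotZl mulN1r. Qed.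

Lemma L2_dotBl u v w : L2_dot (u - v) w = L2_dot u w - L2_dot v w.
Proof. by rewrite L2_dotDl L2_dotNl. Qed.

Lemma L2_dotDr u v w : L2_dot w (u + v) = L2_dot w u + L2_dot w v.
Proof. by rewrite !(L2_dotC w) L2_dotDl. Qed.

Lemma L2_dotZr a u v : L2_dot u (a *: v) = a * L2_dot u v.
Proof. by rewrite !(L2_dotC u) L2_dotZl. Qed.

Lemma L2_dotNr u v : L2_dot u (- v) = - L2_dot u v.
Proof. by rewrite !(L2_dotC u) L2_dotNl. Qed.

Lemma L2_dotBr u v w : L2_dot w (u - v) = L2_dot w u - L2_dot w v.
Proof. by rewrite L2_dotDr L2_dotNr. Qed.

Lemma L2_dot0r u : L2_dot u 0 = 0.
Proof. by rewrite L2_dotC L2_dot0l. Qed.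

Lemma L2_normsqD u v : `|u + v| ^+ 2 = `|u| ^+ 2 + 2 * L2_dot u v + `|v| ^+ 2.
Proof.
by rewrite -!L2_dot_norm L2_dotDl !L2_dotDr (L2_dotC v u); ring.
Qed.

Lemma L2_normsqB u v : `|u - v| ^+ 2 = `|u| ^+ 2 - 2 * L2_dot u v + `|v| ^+ 2.
Proof. by rewrite L2_normsqD L2_dotNr normrN mulrN. Qed.

(** Expanding | |v| u - |u| v |^2 >= 0 leaves 2 |u| |v| (|u| |v| - <u, v>) >= 0; the lower bound is
    the same inequality for -u. *)
Lemma L2_cauchy_schwarz u v : `|L2_dot u v| <= `|u| * `|v|.
Proof.
have le u' v' : L2_dot u' v' <= `|u'| * `|v'|.
  have [->|u0] := eqVneq u' 0; first by rewrite L2_dot0l normr0 mul0r.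
  have [->|v0] := eqVneq v' 0; first by rewrite L2_dot0r normr0 mulr0.
  have := sqr_ge0 `| `|v'| *: u' - `|u'| *: v'|.
  rewrite L2_normsqB L2_dotZl L2_dotZr !normrZ !normr_id.
  have p : 0 < `|u'| * `|v'| by rewrite mulr_gt0 ?normr_gt0.
  move=> h.
  have : 0 <= 2 * (`|u'| * `|v'|) * (`|u'| * `|v'| - L2_dot u' v').
    by apply: le_trans h _; rewrite le_eqVlt; apply/orP; left; apply/eqP; ring.
  by rewrite pmulr_rge0 ?mulr_gt0 ?normr_gt0// subr_ge0.
rewrite ler_norml le andbT lerNl -L2_dotNl.
by rewrite (le_trans (le _ _))// normrN.
Qed.

Lemma L2_parallelogram u v :
  `|u + v| ^+ 2 + `|u - v| ^+ 2 = 2 * `|u| ^+ 2 + 2 * `|v| ^+ 2.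
Proof. by rewrite L2_normsqD L2_normsqB; ring. Qed.

(* Riesz-Fischer. Along a subsequence with |u_(k+1) - u_k| <= 4^-k, the function
   sum_k 4^k (u_(k+1) - u_k)^2 is integrable, hence finite almost everywhere,
   and there the increments are O(2^-k). *)
Lemma L2_fast_ae_cvg (u : nat -> E) :
  (forall k, `|u k.+1 - u k| <= (4^-1) ^+ k) ->
  {ae mu, forall x, cvgn (fun k => u k x)}.
Proof.
move=> uB.
pose s k x : \bar R := (4 ^+ k * (u k.+1 x - u k x) ^+ 2)%:E.
have ms k : measurable_fun setT (s k).
  apply/measurable_EFinP; apply: measurable_funM => //.
  by apply: measurable_funX; apply: measurable_funB; exact: L2_measurable.
have s0 k x : (0 <= s k x)%E by rewrite /s lee_fin mulr_ge0 ?sqr_ge0 ?exprn_ge0.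
have intsE k : (\int[mu]_x s k x <= ((4^-1) ^+ k)%:E)%E.
  have -> : (\int[mu]_x s k x = (4 ^+ k * `|u k.+1 - u k| ^+ 2)%:E)%E.
    have mm := @L2_measurable.
    rewrite EFinM L2_normsqE -(@ge0_integralZl _ _ _ mu _ measurableT (fun x => ((L2_fun (u k.+1 - u k) x) ^+ 2)%:E)).
    2: by apply/measurable_EFinP/measurable_funX.
    2: by move=> x _; rewrite lee_fin sqr_ge0.
    2: by rewrite lee_fin exprn_ge0.
    apply: ae_eq_integral => //.
      apply: measurable_funeM; apply/measurable_EFinP/measurable_funX; exact: mm.
    have := L2_addE (u k.+1) (- u k); have := L2_scaleE (-1) (u k).
    rewrite scaleN1r; apply: filterS2 => x e1 e2 _.
    by rewrite /s -EFinM e2// e1// mulN1r.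
  rewrite lee_fin (@le_trans _ _ (4 ^+ k * ((4^-1) ^+ k) ^+ 2))//.
    by rewrite ler_pM2l ?exprn_gt0// ler_pXn2r ?nnegrE.
  by rewrite -exprM muln2 -addnn exprD mulrA -exprMn divff// expr1n mul1r.
have iS : (\int[mu]_x (\sum_(0 <= k <oo) s k x) < +oo)%E.
  rewrite integral_nneseries//.
  apply: (@le_lt_trans _ _ (\sum_(0 <= k <oo) ((4^-1 : R) ^+ k)%:E)%E).
    by apply: lee_nneseries => // k; first by rewrite integral_ge0.
  apply: (@le_lt_trans _ _ (2%:E)); last exact: ltry.
  apply: lime_le.
    by apply: is_cvg_nneseries => k _ _; rewrite lee_fin exprn_ge0 ?invr_ge0.
  apply: nearW => n; rewrite sumEFin lee_fin.
  have -> : \sum_(0 <= i < n) (4^-1 : R) ^+ i = 4 / 3 * (1 - (4^-1) ^+ n).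
    elim: n => [|n ih]; first by rewrite big_geq// expr0 subrr mulr0.
    by rewrite big_nat_recr//= ih exprS; field.
  have : 0 <= (4^-1 : R) ^+ n by rewrite exprn_ge0 ?invr_ge0.
  lra.
have mS : measurable_fun setT (fun x => \sum_(0 <= k <oo) s k x)%E.
  by apply: ge0_emeasurable_sum.
have iS' : mu.-integrable setT (fun x => \sum_(0 <= k <oo) s k x)%E.
  apply/integrableP; split => //.
  rewrite (eq_integral (fun x => \sum_(0 <= k <oo) s k x)%E)// => x _.
  by rewrite gee0_abs// nneseries_ge0.
have := integrable_ae measurableT iS'.
apply: filterS => x /(_ I) Sfin.
pose S := fine (\sum_(0 <= k <oo) s k x)%E.
have S0 : 0 <= S by rewrite fine_ge0// nneseries_ge0.
have dB k : `|u k.+1 x - u k x| <= geometric (Num.sqrt S) 2^-1 k.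
  rewrite /= -(@ler_pXn2r _ 2)// ?nnegrE ?mulr_ge0 ?exprn_ge0//.
  rewrite exprMn sqr_sqrtr// -exprM mulnC exprM real_normK ?num_real//.
  have -> : (2^-1 ^+ 2 : R) = 4^-1 by field.
  rewrite exprVn ler_pdivlMr ?exprn_gt0// mulrC.
  rewrite -lee_fin /S fineK//.
  rewrite (nneseriesD1 (n := k))//.
  by rewrite leeDl// nneseries_ge0.
have cd : cvgn (series (fun k => u k.+1 x - u k x)).
  apply: normed_cvg; apply: (@series_le_cvg _ _ (geometric (Num.sqrt S) 2^-1)) => //.
  - by move=> k; exact: normr_ge0.
  - by move=> k; rewrite /= mulr_ge0 ?exprn_ge0.
  - by apply: is_cvg_geometric_series; rewrite gtr0_norm ?invf_lt1// ltr1n.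
rewrite (_ : (fun k => u k x) = (fun k => u 0 x + series (fun k => u k.+1 x - u k x) k)).
  by apply: is_cvgD => //; exact: is_cvg_cst.
apply/funext => k; rewrite /series/= telescope_sumr//; first by ring.
Qed.

(** By Fatou's lemma in m, a bound |u_m - u_n| <= e valid for all large m, n passes to |u_n - l| <=
    e. Carrying this implication in the conclusion lets the limit inherit the Cauchy estimates of
    the sequence. *)
Lemma L2_fast_cvg (u : nat -> E) :
  (forall k, `|u k.+1 - u k| <= (4^-1) ^+ k) ->
  exists l : E, forall e, 0 < e ->
    (exists n0, forall m n, (n0 <= m)%N -> (n0 <= n)%N -> `|u m - u n| <= e) ->
    exists n0, forall n, (n0 <= n)%N -> `|u n - l| <= e.
Proof.
move=> /L2_fast_ae_cvg ucvg.
have mu_ := @L2_measurable.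
(* An upper limit is measurable without any convergence assumption, and it is the pointwise limit
   almost everywhere. *)
pose f x : R := fine (limn_esup (fun n => (u n x)%:E)).
have mf : measurable_fun setT f.
  apply: measurableT_comp => //; apply: measurable_fun_limn_esup => n.
  exact/measurable_EFinP.
have uf : {ae mu, forall x, (fun n => u n x) @ \oo --> f x}.
  apply: filterS ucvg => x cx.
  have cx' : (fun n => (u n x)%:E) @ \oo --> (limn (fun n => u n x))%:E.
    by apply: cvg_EFin; [exact: nearW|exact: cx].
  by rewrite /f is_cvg_limn_esupE ?(cvg_lim _ cx')//; apply/cvg_ex; eexists; exact: cx'.
have key e n0 : (forall m n, (n0 <= m)%N -> (n0 <= n)%N -> `|u m - u n| <= e) ->
    forall n, (n0 <= n)%N -> (\int[mu]_x ((u n x - f x) ^+ 2)%:E <= (e ^+ 2)%:E)%E.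
  move=> ue n n0n.
  pose g m x := ((u n x - u (m + n)%N x) ^+ 2)%:E.
  have mg m : measurable_fun setT (g m).
    by apply/measurable_EFinP/measurable_funX/measurable_funB.
  have gE m : (\int[mu]_x g m x = (`|u n - u (m + n)%N| ^+ 2)%:E)%E.
    rewrite L2_normsqE; apply: ae_eq_integral => //.
      by apply/measurable_EFinP/measurable_funX.
    have := L2_addE (u n) (- u (m + n)%N); have := L2_scaleE (-1) (u (m + n)%N).
    rewrite scaleN1r; apply: filterS2 => x e1 e2 _.
    by rewrite /g e2// e1// mulN1r.
  apply: (@le_trans _ _ (\int[mu]_x limn_einf (g^~ x))%E).
    rewrite le_eqVlt; apply/orP; left; apply/eqP; apply: ae_eq_integral => //.
    - by apply/measurable_EFinP/measurable_funX/measurable_funB.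
    - rewrite (_ : (fun x => _) = (fun x => - limn_esup (fun m => - g m x))%E).
        apply: measurableT_comp => //; apply: measurable_fun_limn_esup => m.
        exact: measurableT_comp.
      by apply/funext => x; rewrite limn_esupN oppeK.
    apply: filterS uf => x ux _.
    have : (g^~ x) @ \oo --> ((u n x - f x) ^+ 2)%:E.
      apply: cvg_EFin; first exact: nearW.
      rewrite (_ : fine \o _ = fun m => (u n x - u (m + n)%N x) * (u n x - u (m + n)%N x))//.
      rewrite expr2; apply: cvgM; apply: cvgB; (try exact: cvg_cst);
        by have := ux; rewrite -(cvg_shiftn n).
    by move=> gx; rewrite is_cvg_limn_einfE ?(cvg_lim _ gx)//; apply/cvg_ex; eexists; exact: gx.
  apply: le_trans (fatou mu measurableT mg _) _; first by move=> m x _; rewrite lee_fin sqr_ge0.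
  rewrite limn_einf_lim; apply: lime_le; first exact: is_cvg_einfs.
  apply: nearW => m; apply: (@le_trans _ _ (\int[mu]_x g m x)%E).
    by apply: ereal_inf_lbound => /=; exists m => //=.
  rewrite gE lee_fin lerXn2r ?nnegrE//; last by rewrite ue// (leq_trans n0n)// leq_addl.
  by apply: le_trans (ue n n n0n n0n); rewrite subrr normr0.
(* One Cauchy bound is used to construct the limit. If there were none, the premise of the claim
   would never hold and [l = 0] would do. *)
have [|nocauchy] := pselect (exists e n0, 0 < e /\
    forall m n, (n0 <= m)%N -> (n0 <= n)%N -> `|u m - u n| <= e); last first.
  exists 0 => e e0 [n0 ue]; exfalso; apply: nocauchy; by exists e, n0.
move=> [e0 [k0 [e00 uk0]]].
(* Fatou bounds u_k0 - f rather than f, so the limit is obtained as u_k0 minus the class of this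
   difference. *)
have d2 : (fun x => u k0 x - f x) \in Lfun mu 2%:E.
  apply: sqr_integrable_Lfun; first exact: measurable_funB.
  by apply: le_lt_trans (key _ _ uk0 k0 (leqnn _)) (ltry _).
have [w wf] := L2_exists d2.
pose l := u k0 - w.
have lf : L2_fun l = f %[ae mu].
  have := L2_addE (u k0) (- w); have := L2_scaleE (-1) w.
  rewrite scaleN1r; move: wf; apply: filterS3 => x e1 e2 e3 _.
  by rewrite e3// e2// e1//; ring.
exists l => e e_gt0 [n0 ue]; exists n0 => n n0n.
rewrite -(@ler_pXn2r _ 2)// ?nnegrE// ?(ltW e_gt0)// -lee_fin L2_normsqE.
apply: le_trans (key _ _ ue n n0n); rewrite le_eqVlt; apply/orP; left; apply/eqP.
apply: ae_eq_integral => //.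
- by apply/measurable_EFinP/measurable_funX.
- by apply/measurable_EFinP/measurable_funX/measurable_funB.
have := L2_addE (u n) (- l); have := L2_scaleE (-1) l.
rewrite scaleN1r; move: lf; apply: filterS3 => x e1 e2 e3 _.
by rewrite e3// e2// e1// mulN1r.
Qed.

Lemma L2_complete (u : nat -> E) :
  (forall e, 0 < e -> exists n0, forall m n, (n0 <= m)%N -> (n0 <= n)%N ->
     `|u m - u n| <= e) ->
  exists l : E, forall e, 0 < e -> exists n0, forall n, (n0 <= n)%N -> `|u n - l| <= e.
Proof.
move=> uC.
have e4 k : 0 < (4^-1 : R) ^+ k by rewrite exprn_gt0// invr_gt0.
have /choice[N NP] := fun k => uC _ (e4 k).
(* [p] is strictly increasing and dominates [N], so [p k] and [p k.+1] both lie beyond the index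
   from which terms differ by at most 4^-k. *)
pose fix p k := if k is k'.+1 then maxn (p k').+1 (N k'.+1) else N 0%N.
have pN k : (N k <= p k)%N by case: k => //= k; rewrite leq_maxr.
have pS k : (p k < p k.+1)%N by rewrite /= leq_maxl.
have pk k : (k <= p k)%N by elim: k => // k ih; exact: leq_ltn_trans (pS k).
have [|l lP] := @L2_fast_cvg (u \o p).
  move=> k /=; apply: NP => //; apply: leq_trans (pN k) (ltnW (pS k)).
exists l => e e0; have e20 : 0 < e / 2 by rewrite divr_gt0.
have [n0 n0P] := uC _ e20.
have [|n1 n1P] := lP _ e20.
  by exists n0 => m n nm nn /=; apply: n0P; exact: leq_trans (pk _).
exists n0 => n nn; rewrite (splitr e) -(subrKA (u (p (maxn n0 n1)))).
rewrite (le_trans (ler_normD _ _))// lerD//.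
  by apply: n0P => //; apply: leq_trans (pk _); exact: leq_maxl.
by apply: n1P; exact: leq_maxr.
Qed.


Definition L2_subspace (M : set E) : Prop :=
  M 0 /\ forall a u v, M u -> M v -> M (a *: u + v).

Definition L2_closed (M : set E) : Prop :=
  forall u, (forall e, 0 < e -> exists2 v, M v & `|u - v| <= e) -> M u.

Lemma L2_subspaceZ M a u : L2_subspace M -> M u -> M (a *: u).
Proof. by move=> [M0 MP] Mu; rewrite -[a *: u]addr0; exact: MP. Qed.

Lemma L2_subspaceD M u v : L2_subspace M -> M u -> M v -> M (u + v).
Proof. by move=> [M0 MP] Mu Mv; rewrite -[u]scale1r; exact: MP. Qed.

(* The minimizer of |w|^2 - 2 l(w) over M represents l. *)
Lemma L2_riesz (M : set E) (l : E -> R) (C : R) :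
  L2_subspace M -> L2_closed M ->
  (forall a u v, M u -> M v -> l (a *: u + v) = a * l u + l v) ->
  (forall u, M u -> `|l u| <= C * `|u|) ->
  exists2 w, M w & forall u, M u -> L2_dot u w = l u.
Proof.
move=> sM cM lP lC; have [M0 MP] := sM.
have l0 : l 0 = 0.
  by have := lP 1 0 0 M0 M0; rewrite scale1r addr0 mul1r => /eqP; rewrite -subr_eq subrr eq_sym => /eqP.
have lZ a u : M u -> l (a *: u) = a * l u.
  by move=> Mu; rewrite -[a *: u]addr0 lP// l0 addr0.
pose J u := `|u| ^+ 2 - 2 * l u.
have JC u : M u -> - C ^+ 2 <= J u.
  move=> Mu; have := lC u Mu; rewrite /J ler_norml => /andP[_ h].
  have := sqr_ge0 (`|u| - C); rewrite sqrrB; lra.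
pose S := [set J u | u in M].
have hS : has_inf S.
  by split; [exists (J 0), 0|exists (- C ^+ 2) => _ [u Mu <-]; exact: JC].
have /choice[u uP] k : exists u, M u /\ J u < inf S + k.+1%:R^-1.
  have k0 : 0 < (k.+1%:R^-1 : R) by rewrite invr_gt0.
  by have [_ [u Mu <-] h] := inf_adherent k0 hS; exists u.
have infJ v : M v -> inf S <= J v.
  by move=> Mv; apply: ge_inf; [case: hS|exists v].
(* The midpoint of v and w lies in M, so the parallelogram identity bounds |v - w|^2 by the excess
   of [J] over its infimum. Minimizing sequences are therefore Cauchy. *)
have parJ v w : M v -> M w -> `|v - w| ^+ 2 <= 2 * J v + 2 * J w - 4 * inf S.
  move=> Mv Mw.
  have := infJ _ (L2_subspaceZ 2^-1 sM (L2_subspaceD sM Mv Mw)).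
  have Mvw := L2_subspaceD sM Mv Mw.
  rewrite /J lZ// -[in l (v + w)](scale1r v) lP// mul1r normrZ exprMn gtr0_norm ?invr_gt0//.
  have := L2_parallelogram v w; have -> : (2^-1 : R) ^+ 2 = 4^-1 by field.
  lra.
have small := @eventually_invn_le R.
have [|w wP] := @L2_complete u.
  move=> e e0; have [|n0 n0P] := small (e ^+ 2 / 4); first by rewrite divr_gt0 ?exprn_gt0.
  exists n0 => m n n0m n0n.
  rewrite -(@ler_pXn2r _ 2)// ?nnegrE// ?(ltW e0)//.
  have [Mm hm] := uP m; have [Mn hn] := uP n.
  move: (parJ _ _ Mm Mn) (n0P _ n0m) (n0P _ n0n) hm hn.
  move: (J (u m)) (J (u n)) (inf S) (m.+1%:R^-1) (n.+1%:R^-1) `|u m - u n| => a b c a' b' f.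
  lra.
have Mw : M w.
  apply: cM => e e0; have [n0 n0P] := wP e e0.
  by exists (u n0); [have [] := uP n0|rewrite distrC; exact: n0P].
have Jw : J w <= inf S.
  apply/ler_addgt0Pr => e e0.
  have [|n1 n1P] := small (e / 2); first by rewrite divr_gt0.
  (* J(w + v) - J(w) = |v|^2 + 2 <v, w> - 2 l(v) is at least -(2 |w| + 2 |C|) |v|; the added 1 makes
     [K] positive. *)
  pose K := 2 * `|w| + 2 * `|C| + 1.
  have K0 : 0 < K by rewrite /K; have := normr_ge0 w; have := normr_ge0 C; lra.
  have [|n0 n0P] := wP (Num.min 1 (e / 2 / K)).
    by rewrite lt_min ltr01 !divr_gt0.
  pose n := maxn n0 n1.
  have := n0P n (leq_maxl _ _); rewrite le_min => /andP[h1 h2].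
  have h3 := n1P n (leq_maxr _ _); have [Mn hn] := uP n.
  have arith (v2 dv w2 lv lw Cv aCv vw nv : R) : - vw <= dv -> lv <= Cv ->
      Cv <= aCv -> 0 <= v2 -> 0 <= nv ->
      w2 - 2 * lw <= v2 + 2 * dv + w2 - 2 * (lv + lw) + (2 * vw + 2 * aCv + nv).
    by clear; lra.
  suff : J w <= J (u n) + K * `|u n - w|.
    have : K * `|u n - w| <= e / 2 by rewrite mulrC -ler_pdivlMr.
    move: (n.+1%:R^-1) hn h3 => a hn h3; lra.
  set v := u n - w in h1 h2 *.
  have Mv : M v by rewrite /v addrC -scaleN1r; exact: MP.
  have -> : u n = 1 *: v + w by rewrite scale1r subrK.
  rewrite /J lP// mul1r scale1r L2_normsqD.
  have := lC v Mv; have := L2_cauchy_schwarz v w.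
  rewrite !ler_norml => /andP[a1 a2] /andP[b1 b2].
  have : C * `|v| <= `|C| * `|v| by rewrite ler_wpM2r// ler_norm.
  have := sqr_ge0 `|v|; have := normr_ge0 v.
  have -> : K * `|v| = 2 * (`|v| * `|w|) + 2 * (`|C| * `|v|) + `|v| by rewrite /K; ring.
  by move=> v0 v20 CC; refine (arith _ _ _ _ _ _ _ _ _ a1 b2 CC v20 v0).
exists w => // v Mv.
(* This is J(t v + w) - J(w) >= 0. A nonnegative quadratic in t without constant term has no linear
   term: this is read off at t = 1 and t = -1 if |v| = 0, and at the vertex t = -c / |v|^2
   otherwise. *)
have quad t : 0 <= t ^+ 2 * `|v| ^+ 2 + 2 * t * (L2_dot v w - l v).
  have := infJ _ (MP t v w Mv Mw); move: Jw; rewrite /J lP// L2_normsqD normrZ exprMn.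
  rewrite real_normK ?num_real// L2_dotZl; lra.
set c := L2_dot v w - l v in quad.
suff : c = 0 by rewrite /c => /eqP; rewrite subr_eq0 => /eqP.
have [v0|v0] := eqVneq (`|v| ^+ 2) 0.
  by have := quad 1; have := quad (-1); rewrite v0; lra.
have vp : 0 < `|v| ^+ 2 by rewrite lt_def v0 sqr_ge0.
have := quad (- c / `|v| ^+ 2).
have -> : (- c / `|v| ^+ 2) ^+ 2 * `|v| ^+ 2 + 2 * (- c / `|v| ^+ 2) * c = - (c ^+ 2 / `|v| ^+ 2).
  by move: v0; move: (`|v| ^+ 2) => q q0; field.
rewrite oppr_ge0 ler_pdivrMr// mul0r => c0.
by apply/eqP; rewrite -sqrf_eq0 eq_le c0 sqr_ge0.
Qed.

(** The projection of u is the vector of M that represents the functional v |-> <v, u>. *)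
Lemma L2_projection (M : set E) u : L2_subspace M -> L2_closed M ->
  exists2 w, M w & forall v, M v -> L2_dot v (u - w) = 0.
Proof.
move=> sM cM.
have [||w Mw wP] := @L2_riesz M (fun v => L2_dot v u) `|u| sM cM.
- by move=> a v w _ _; rewrite L2_dotPl.
- by move=> v _; rewrite mulrC; exact: L2_cauchy_schwarz.
by exists w => // v Mv; rewrite L2_dotBr wP// subrr.
Qed.

Lemma L2_closure_subspace (M : set E) : L2_subspace M ->
  L2_subspace [set u | forall e, 0 < e -> exists2 v, M v & `|u - v| <= e].
Proof.
move=> [M0 MP]; split=> [e e0|a u v uM vM e e0]; first by exists 0; rewrite ?subrr ?normr0 ?ltW.
have ap : 0 < `|a| + 1 by rewrite ltr_wpDl.
have [|u' Mu uu'] := uM (e / 2 / (`|a| + 1)); first by rewrite !divr_gt0.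
have [|v' Mv vv'] := vM (e / 2); first by rewrite divr_gt0.
exists (a *: u' + v'); first exact: MP.
have -> : a *: u + v - (a *: u' + v') = a *: (u - u') + (v - v').
  by rewrite scalerBr opprD addrACA.
rewrite (le_trans (ler_normD _ _))// (splitr e) lerD// normrZ.
move: uu'; rewrite ler_pdivlMr// mulrC; apply: le_trans.
by rewrite ler_wpM2r// lerDl.
Qed.

Lemma L2_closure_closed (M : set E) :
  L2_closed [set u | forall e, 0 < e -> exists2 v, M v & `|u - v| <= e].
Proof.
move=> u uM e e0.
have e20 : 0 < e / 2 by rewrite divr_gt0.
have [v vM uv] := uM _ e20; have [w Mw vw] := vM _ e20.
exists w => //; rewrite (splitr e) -(subrKA v).
by rewrite (le_trans (ler_normD _ _))// lerD.
Qed.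

(** The difference of u and its projection on the closure of M is orthogonal to M, hence 0. *)
Lemma L2_dense_of_ortho (M : set E) : L2_subspace M ->
  (forall u, (forall v, M v -> L2_dot u v = 0) -> u = 0) ->
  forall u e, 0 < e -> exists2 v, M v & `|u - v| <= e.
Proof.
move=> sM M0 u e e0.
have [w wM uw] := L2_projection u (L2_closure_subspace sM) (@L2_closure_closed M).
suff -> : u = w by exact: wM.
apply/eqP; rewrite -subr_eq0; apply/eqP; apply: M0 => v Mv; rewrite L2_dotC; apply: uw.
by move=> e' e'0; exists v; rewrite // subrr normr0 ltW.
Qed.

Lemma closed_L2 (M : set E) : L2_closed M -> closed M.
Proof.
move=> cM u uM; apply: cM => e e0.
have [v [Mv uv]] := uM (ball u e) (nbhsx_ballx u e e0).
by exists v => //; move: uv; rewrite -ball_normE => /ltW.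
Qed.

End L2_hilbert.

(** * Integration over R^N *)

Section mrestr_integral.
Context {d : measure_display} {T : measurableType d} {R : realType}.
Variables (mu : {measure set T -> \bar R}) (D : set T) (mD : measurable D).
Local Open Scope ereal_scope.

(** On subsets of D, [mu] agrees with the sum of its restrictions to D and to the complement. The
    second restriction gives D measure 0, and the first gives the complement measure 0. *)
Lemma ge0_integral_mrestr (f : T -> \bar R) : measurable_fun setT f ->
  (forall x, 0 <= f x) ->
  \int[mrestr mu mD]_x f x = \int[mu]_(x in D) f x.
Proof.
move=> mf f0; pose mDc := measurableC mD.
have mfS A : measurable_fun A f by exact: measurable_funTS.
have -> : \int[mu]_(x in D) f x =
    \int[measure_add (mrestr mu mD) (mrestr mu mDc)]_(x in D) f x.
  apply: eq_measure_integral => A mA AD.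
  apply: etrans (esym (measure_addE _ _ _)); rewrite /= /mrestr (setIidl AD).
  rewrite (_ : A `&` ~` D = set0) ?measure0 ?adde0//.
  by apply/disjoints_subset; rewrite setCK.
rewrite ge0_integral_measure_add//.
rewrite (@null_set_integral _ _ _ (mrestr mu mDc) D)//; last first.
  by rewrite /= /mrestr setICr measure0.
rewrite adde0 -(setUv D) ge0_integral_setU//; last first.
- by apply/disj_setPS; rewrite setICr.
rewrite [X in _ + X](@null_set_integral _ _ _ (mrestr mu mD) (~` D))// ?adde0//.
by rewrite /= /mrestr setICl measure0.
Qed.

Lemma integral_mrestr (f : T -> \bar R) : measurable_fun setT f ->
  \int[mrestr mu mD]_x f x = \int[mu]_(x in D) f x.
Proof.
move=> mf; rewrite [LHS]integralE [RHS]integralE.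
by rewrite !ge0_integral_mrestr//; [exact: measurable_funeneg|exact: measurable_funepos].
Qed.

Lemma integral_mrestr_supp (f : T -> \bar R) : measurable_fun setT f ->
  (forall x, ~ D x -> f x = 0) ->
  \int[mrestr mu mD]_x f x = \int[mu]_x f x.
Proof.
move=> mf f0; rewrite integral_mrestr// integral_mkcond; apply: eq_integral => x _.
by rewrite patchE; case: ifPn => // /negP xD; rewrite f0// => Dx; apply: xD; rewrite inE.
Qed.

End mrestr_integral.

Lemma continuous_measurable_rV (R : realType) N (f : 'rV[R]_N -> R) :
  continuous f -> measurable_fun setT f.
Proof.
move=> cf; apply: (measurability _ (RGenOInfty.measurableE R)) => //.
move=> _ [_ [a ->] <-]; rewrite setTI; apply: open_measurable_rV.
by apply: open_comp => //; exact: interval_open.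
Qed.

Definition rV_box (R : realType) N (a b : 'I_N -> R) : set 'rV[R]_N :=
  [set x | forall i, a i < x ord0 i < b i].

Lemma measurable_rV_box (R : realType) N (a b : 'I_N -> R) : measurable (rV_box a b).
Proof.
rewrite (_ : rV_box a b =
    \bigcap_(i in [set: 'I_N]) ((@rV_coord R N i) @^-1` `]a i, b i[)).
  apply: fin_bigcap_measurable => // i _.
  rewrite -[X in measurable X]setTI; apply: measurable_rV_coord => //.
apply/seteqP; split=> [x xab i _ /=|x xab i]; first by rewrite in_itv/=; exact: xab.
by have := xab i I; rewrite /= in_itv.
Qed.

Lemma lebesgue_rV_boxE (R : realType) N (a b : 'I_N.+1 -> R) :
  lebesgue_rV R N.+1 (rV_box a b) =
  (lebesgue_measure `]a ord0, b ord0[%classic *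
   lebesgue_rV R N (rV_box (fun i => a (lift ord0 i)) (fun i => b (lift ord0 i))))%E.
Proof.
rewrite /= /pushforward -product_measure1E//; last exact: measurable_rV_box.
congr ((_ \x _)%E _); apply/seteqP; split=> -[x y] /=.
  move=> h; split=> /=; first by have := h ord0; rewrite mxE unlift_none /= in_itv.
  by move=> i; have := h (lift ord0 i); rewrite mxE liftK.
move=> [/=]; rewrite in_itv /= => h1 h2 i; rewrite mxE.
by case: unliftP => [j ->|->] //=.
Qed.

Lemma lebesgue_rV_box_lty (R : realType) N (a b : 'I_N -> R) :
  (lebesgue_rV R N (rV_box a b) < +oo)%E.
Proof.
elim: N a b => [|N ih] a b.
  by rewrite /= diracE; exact: ltry.
rewrite lebesgue_rV_boxE lte_mul_pinfty//.
by rewrite lebesgue_measure_itv/=; case: ifP.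
Qed.

(** * Integrals of derivatives of functions with bounded support *)

Section bounded_support.
Context {R : realType}.

(* Unlike test functions, this class is stable under freezing a coordinate, as the
   induction on N in integral_pderiv requires. *)
Definition cbs N (f : 'rV[R]_N -> R) : Prop := continuous f /\
  exists M, forall x, `|f x| <= M /\ (f x != 0 -> rV_box (fun=> - M) (fun=> M) x).

Lemma cbs_integrable N (f : 'rV[R]_N -> R) : cbs f ->
  (lebesgue_rV R N).-integrable setT (EFin \o f).
Proof.
move=> [cf [M fM]].
have M0 : 0 <= M by apply: le_trans (fM 0).1; rewrite normr_ge0.
have mf := continuous_measurable_rV cf.
pose B : set 'rV[R]_N := rV_box (fun=> - M) (fun=> M).
have mB : measurable B by exact: measurable_rV_box.
apply: (@le_integrable _ _ _ _ _ measurableT _ (fun x => (M * \1_B x)%:E)).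
- exact/measurable_EFinP.
- move=> x _; have [fx Bx] := fM x; rewrite lee_fin (le_trans _ (ler_norm _))// indicE.
  have [->|/Bx xB] := eqVneq (f x) 0; first by rewrite normr0 mulr_ge0.
  by rewrite mem_set// mulr1.
- apply/integrableP; split.
    by apply/measurable_EFinP; apply: measurable_funM => //; exact: measurable_indic.
  under eq_integral => x _ do rewrite abse_EFin normrM (ger0_norm M0) (ger0_norm (_ : 0 <= \1_B x)) ?indicE// EFinM.
  rewrite ge0_integralZl//; last by apply/measurable_EFinP; exact: measurable_indic.
  rewrite lte_mul_pinfty ?lee_fin// -?indicE.
  by under eq_integral do rewrite -indicE; rewrite integral_indic// setIT lebesgue_rV_box_lty.
Qed.

Lemma cbs_integrable_prod N (f : 'rV[R]_N.+1 -> R) : cbs f ->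
  (lebesgue_measure \x lebesgue_rV R N)%E.-integrable setT (EFin \o f \o rV_cons).
Proof.
move=> cf; have /integrableP[mf iff] := cbs_integrable cf.
apply/integrableP; split.
  by apply: measurableT_comp mf _; exact: measurable_rV_cons.
move: iff; rewrite /= ge0_integral_pushforward//=.
by apply/measurable_EFinP; apply: measurableT_comp => //; exact/measurable_EFinP.
Qed.

Lemma lebesgue_rV_integralS N (f : 'rV[R]_N.+1 -> R) : cbs f ->
  (\int[lebesgue_rV R N.+1]_x (f x)%:E =
   \int[lebesgue_measure \x lebesgue_rV R N]_z (f (rV_cons z))%:E)%E.
Proof.
move=> cf; rewrite /= integral_pushforward//.
  by have /integrableP[] := cbs_integrable cf.
exact: cbs_integrable_prod.
Qed.

(** The two difference quotients are the same function of h. This transfers partial derivatives to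
    slices with frozen coordinates, to lines, to translates and to affine functions of one
    coordinate. *)
Lemma derive_slice (V W : normedModType R) (f : W -> R) (c : V -> W) (v y : V) (w : W) :
  (forall h : R, c (h *: v + y) = h *: w + c y) ->
  (derivable (f \o c) y v <-> derivable f (c y) w) /\ 'D_v (f \o c) y = 'D_w f (c y).
Proof.
move=> cE; rewrite /derivable /derive.
by rewrite (_ : (fun h => _) = (fun h : R => h^-1 *: ((f \o shift (c y)) (h *: w) - f (c y))))//;
  apply/funext => h /=; rewrite cE.
Qed.

Lemma continuous_rV_cons N (x : R) (y : 'rV[R]_N) :
  continuous (fun t : R => @rV_cons R N (t, y)) /\
  continuous (fun z => @rV_cons R N (x, z)).
Proof.
split=> t; apply/(@cvg_ballP _ _ _ _ (nbhs_filter t)) => e e0; near=> z; split=> // i j; rewrite !mxE.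
  case: (unlift _ _) => [k|] /=; first exact: ballxx.
  by near: z; exact: nbhsx_ballx.
case: (unlift _ _) => [k|] /=; last exact: ballxx.
have : ball t e z by near: z; exact: nbhsx_ballx.
by move=> [_]; exact.
Unshelve. all: by end_near. Qed.

Lemma cbs_rV_cons N (f : 'rV[R]_N.+1 -> R) x : cbs f ->
  cbs (fun y => f (@rV_cons R N (x, y))).
Proof.
move=> [cf [M fM]]; split.
  by move=> y; apply: continuous_comp; [exact: (continuous_rV_cons x y).2|exact: cf].
exists M => y; have [f1 f2] := fM (rV_cons (x, y)); split=> // /f2 h i.
by have := h (lift ord0 i); rewrite mxE liftK.
Qed.

Lemma rV_consD0 N h t (y : 'rV[R]_N) :
  @rV_cons R N (h *: 1 + t : R, y) =
  h *: delta_mx ord0 ord0 + @rV_cons R N (t, y).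
Proof.
apply/rowP => i; rewrite !mxE; case: unliftP => [j ->|->] /=.
  by rewrite mulr0 add0r.
by [].
Qed.

Lemma rV_consD N h (x : measurableTypeR R) (y : 'rV[R]_N) (j : 'I_N) :
  rV_cons (x, h *: delta_mx ord0 j + y) =
  h *: delta_mx ord0 (lift ord0 j) + rV_cons (x, y).
Proof.
apply/rowP => i; rewrite !mxE; case: unliftP => [k ->|->] /=.
  by rewrite !mxE (inj_eq (@lift_inj _ _)).
by rewrite mulr0 add0r.
Qed.

(** The fundamental theorem of calculus on [-M, M]; the points -M and M are among those where f
    vanishes. *)
Lemma integral_derive1_supp (f g : R -> R) (M : R) : 0 < M ->
  (forall t : R, derivable f t 1) -> f^`()%classic = g -> continuous g ->
  (forall t, ~ (- M < t < M) -> f t = 0 /\ g t = 0) ->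
  (\int[@lebesgue_measure R]_x (g x)%:E = 0)%E.
Proof.
move=> M0 df dg cg fg0.
have cf : continuous f by move=> t; exact/differentiable_continuous/derivable1_diffP.
transitivity (\int[@lebesgue_measure R]_(x in `[(- M)%R, M]) (g x)%:E)%E.
  rewrite [RHS]integral_mkcond; apply: eq_integral => t _; rewrite patchE.
  case: ifPn => // /negP h; rewrite (fg0 t _).2// => /andP[h1 h2]; apply: h.
  by rewrite inE /= in_itv /= !ltW.
rewrite (@continuous_FTC2 R g f).
- rewrite (fg0 M _).1 ?(fg0 (- M) _).1 ?subee//; first by rewrite ltxx.
  by rewrite ltxx andbF.
- by rewrite gtrN.
- exact: continuous_subspaceT.
- split=> [t _||]; first exact: df.
  + by apply: cvg_at_right_filter; exact: cf.
  + by apply: cvg_at_left_filter; exact: cf.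
- by move=> t _; rewrite dg.
Qed.

(** By Fubini it is enough that an inner integral vanishes. For a derivative in the first
    coordinate, the inner integral is over that coordinate and the one-dimensional case applies;
    otherwise the first coordinate is frozen and the induction hypothesis applies to the slice. *)
Lemma integral_pderiv N (f : 'rV[R]_N -> R) (i : 'I_N) : cbs f ->
  (forall x, derivable f x (delta_mx ord0 i)) -> cbs (pderiv i f) ->
  (\int[lebesgue_rV R N]_x (pderiv i f x)%:E = 0)%E.
Proof.
elim: N f i => [f []//|N ih] f i cf df cdf.
rewrite lebesgue_rV_integralS//.
case: (unliftP ord0 i) => [j|] ij; subst i.
  rewrite -integral12_prod_meas1; last exact: cbs_integrable_prod.
  rewrite integral0_eq// => x _; rewrite /fubini_F.
  pose fx y := f (@rV_cons R N (x, y)).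
  have sl y := @derive_slice _ _ f (fun y => @rV_cons R N (x, y))
    (delta_mx ord0 j) y (delta_mx ord0 (lift ord0 j)) (fun h => rV_consD h x y j).
  have dE : pderiv j fx = fun y => pderiv (lift ord0 j) f (rV_cons (x, y)).
    by apply/funext => y; have [_ h] := sl y; exact: h.
  rewrite -[RHS](ih fx j).
  - by apply: eq_integral => y _; rewrite dE.
  - exact: cbs_rV_cons.
  - by move=> y; apply/(sl y).1; exact: df.
  - by rewrite dE; exact: cbs_rV_cons.
rewrite -integral21_prod_meas1; last exact: cbs_integrable_prod.
rewrite integral0_eq// => y _; rewrite /fubini_G.
pose fy (t : R) := f (@rV_cons R N (t, y)).
have sl t := @derive_slice R^o _ f (fun t : R => @rV_cons R N (t, y))
  1 t (delta_mx ord0 ord0) (fun h => rV_consD0 h t y).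
have [_ [M fM]] := cf; have [cdf' [M' fM']] := cdf.
(* A positive radius that covers the supports of both f and its derivative. *)
pose K := Num.max 1 (Num.max M M').
apply: (@integral_derive1_supp fy (fun t => pderiv ord0 f (@rV_cons R N (t, y))) K).
- by rewrite lt_max ltr01.
- by move=> t; apply/(sl t).1; exact: df.
- by apply/funext => t; rewrite derive1E; have [_ h] := sl t; exact: h.
- by move=> t; apply: continuous_comp; [exact: (continuous_rV_cons 0 y).1|exact: cdf'].
- move=> t tK; split; apply/eqP/negPn/negP.
    move=> /(fM _).2 /(_ ord0); rewrite mxE unlift_none /= => /andP[h1 h2]; apply: tK.
    apply/andP; split; first by rewrite (le_lt_trans _ h1)// lerN2 !le_max lexx orbT.
    by rewrite (lt_le_trans h2)// !le_max lexx orbT.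
  move=> /(fM' _).2 /(_ ord0); rewrite mxE unlift_none /= => /andP[h1 h2]; apply: tK.
  apply/andP; split; first by rewrite (le_lt_trans _ h1)// lerN2 !le_max lexx !orbT.
  by rewrite (lt_le_trans h2)// !le_max lexx !orbT.
Qed.

End bounded_support.

(** * Smooth functions *)

Section smooth_functions.
Context {R : realType} {N : nat}.
Implicit Types f g : 'rV[R]_N -> R.
Local Notation e_ i := (delta_mx ord0 i : 'rV[R]_N).

Lemma pderivs_rcons (s : seq 'I_N) i f : pderivs (rcons s i) f = pderivs s (pderiv i f).
Proof. by rewrite /pderivs -cats1 foldr_cat. Qed.

Lemma pderivs_cat (s s' : seq 'I_N) f : pderivs (s ++ s') f = pderivs s (pderivs s' f).
Proof. by rewrite /pderivs foldr_cat. Qed.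

Lemma smooth_pderivs (s : seq 'I_N) f : smooth f -> smooth (pderivs s f).
Proof. by move=> sf s'; rewrite -pderivs_cat; exact: sf. Qed.

Lemma smooth_continuous f : smooth f -> continuous f.
Proof. by move=> /(_ [::]) []. Qed.

Lemma smooth_derivable f x i : smooth f -> derivable f x (e_ i).
Proof. by move=> /(_ [::]) [_]; exact. Qed.

(** A recursion on the order fits the product rule: the derivative of a product is a sum of products
    to which the hypothesis for the lower order applies. *)
Fixpoint Ck (m : nat) f : Prop := continuous f /\
  if m is m'.+1 then forall i, (forall x, derivable f x (e_ i)) /\ Ck m' (pderiv i f)
  else True.

(** The derivative taken first is the last entry of the sequence, hence the induction from the right
    end. *)
Lemma smoothP f : smooth f <-> forall m, Ck m f.
Proof.
split=> [sf m|].
  elim: m f sf => [|m ih] f sf; split=> //; try exact: smooth_continuous.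
  move=> i; split=> [x|]; first exact: smooth_derivable.
  exact: ih (smooth_pderivs [:: i] sf).
move=> fC s; elim/last_ind: s f fC => [|s i ih] f fC.
  by have [cf df] := fC 1%N; split=> // i x; exact: (df i).1.
by rewrite pderivs_rcons; apply: ih => m; have [_ /(_ i) []] := fC m.+1.
Qed.

Lemma CkW m f : Ck m.+1 f -> Ck m f.
Proof.
elim: m f => [|m ih] f [cf df]; split=> // i; split; first exact: (df i).1.
exact/ih/(df i).2.
Qed.

Lemma Ck_cst m (c : R) : Ck m (cst c : 'rV[R]_N -> R).
Proof.
elim: m c => [|m ih] c; split; try exact: cst_continuous; first by [].
move=> i; split=> [x|]; first exact: derivable_cst.
by rewrite (_ : pderiv i _ = cst 0)//; apply/funext => x; exact: derive_cst.
Qed.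

Lemma pderivD i f g : (forall x, derivable f x (e_ i)) -> (forall x, derivable g x (e_ i)) ->
  pderiv i (f + g) = pderiv i f + pderiv i g.
Proof. by move=> df dg; apply/funext => x; exact: deriveD. Qed.

Lemma pderivZ i (a : R) f : (forall x, derivable f x (e_ i)) ->
  pderiv i (a *: f) = a *: pderiv i f.
Proof. by move=> df; apply/funext => x; exact: deriveZ. Qed.

Lemma pderivM i f g : (forall x, derivable f x (e_ i)) -> (forall x, derivable g x (e_ i)) ->
  pderiv i (f * g) = f * pderiv i g + g * pderiv i f.
Proof. by move=> df dg; apply/funext => x; exact: deriveM. Qed.

Lemma CkD m f g : Ck m f -> Ck m g -> Ck m (f + g).
Proof.
elim: m f g => [|m ih] f g [cf df] [cg dg];
    (split; first by move=> x; exact: cvgD (cf x) (cg x)); first by [].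
move=> i; have [dfi Cf] := df i; have [dgi Cg] := dg i.
  split=> [x|]; first exact: derivableD.
  by rewrite pderivD//; exact: ih.
Qed.

Lemma CkZ m (a : R) f : Ck m f -> Ck m (a *: f).
Proof.
elim: m f => [|m ih] f [cf df];
    (split; first by move=> x; exact: cvgZr (cf x)); first by [].
move=> i; have [dfi Cf] := df i.
  split=> [x|]; first exact: derivableZ.
  by rewrite pderivZ//; exact: ih.
Qed.

Lemma CkM m f g : Ck m f -> Ck m g -> Ck m (f * g).
Proof.
elim: m f g => [|m ih] f g Cf Cg; have [cf df] := Cf; have [cg dg] := Cg;
    (split; first by move=> x; exact: cvgM (cf x) (cg x)); first by [].
move=> i; have [dfi Cfi] := df i; have [dgi Cgi] := dg i.
  split=> [x|]; first exact: derivableM.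
  rewrite pderivM//; apply: CkD; apply: ih => //; exact: CkW.
Qed.

Lemma Ck_prod m (I : Type) (r : seq I) (F : I -> 'rV[R]_N -> R) :
  (forall i, Ck m (F i)) -> Ck m (fun x => \prod_(i <- r) F i x).
Proof.
move=> CF; elim: r => [|i r ih].
  rewrite (_ : (fun x => _) = cst 1); first exact: Ck_cst.
  by apply/funext => x; rewrite big_nil.
rewrite (_ : (fun x => _) = F i * (fun x => \prod_(j <- r) F j x)); first exact: CkM.
by apply/funext => x; rewrite big_cons.
Qed.

Lemma smoothP_lin a f g : smooth f -> smooth g -> smooth (a *: f + g).
Proof.
by move=> /smoothP sf /smoothP sg; apply/smoothP => m; apply: CkD => //; exact: CkZ.
Qed.

Lemma pderivsP (s : seq 'I_N) a f g : smooth f -> smooth g ->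
  pderivs s (a *: f + g) = a *: pderivs s f + pderivs s g.
Proof.
elim: s => [//|i s ih] sf sg; rewrite /= ih// pderivD ?pderivZ//.
- by move=> x; apply: smooth_derivable; exact: smooth_pderivs.
- by move=> x; apply: derivableZ; apply: smooth_derivable; exact: smooth_pderivs.
- by move=> x; apply: smooth_derivable; exact: smooth_pderivs.
Qed.

Lemma is_derive_line f (v p : 'rV[R]_N) (s : R) : derivable f (s *: v + p) v ->
  is_derive s 1 (fun t : R => f (t *: v + p)) ('D_v f (s *: v + p)).
Proof.
have cE (h : R) : (h *: 1 + s) *: v + p = h *: v + (s *: v + p).
  by rewrite (_ : h *: 1 = h) ?scalerDl ?addrA//; exact: mulr1.
have [h1 h2] := @derive_slice R R^o _ f (fun t : R => t *: v + p) 1 s v cE.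
by move=> df; split; [exact/h1|exact: h2].
Qed.

Lemma MVT_line f (v p : 'rV[R]_N) (e : R) : 0 < e -> (forall x, derivable f x v) ->
  exists2 s, 0 < s < e & f (e *: v + p) - f p = e * 'D_v f (s *: v + p).
Proof.
move=> e0 df.
have dl s := is_derive_line (df (s *: v + p)).
have [|s] := @MVT R (fun t : R => f (t *: v + p)) (fun s => 'D_v f (s *: v + p)) 0 e e0.
  apply: continuous_subspaceT => s; apply: differentiable_continuous.
  by apply/derivable1_diffP; have [] := dl s.
rewrite in_itv/= subr0 scale0r add0r mulrC => se h.
by exists s.
Qed.

(** The mean value theorem is applied in direction i to y |-> f(e e_j + y) - f(y), and in direction
    j to the derivative so obtained. The left-hand side is symmetric in i and j up to reordering. *)
Lemma second_difference f i j x (e : R) : Ck 2 f -> 0 < e ->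
  exists s t : R, [/\ 0 < s < e, 0 < t < e &
    f (e *: e_ j + (e *: e_ i + x)) - f (e *: e_ i + x) -
      (f (e *: e_ j + x) - f x) =
    e * (e * pderiv j (pderiv i f) (t *: e_ j + (s *: e_ i + x)))].
Proof.
move=> [cf df] e0; have [dfi [cfi dfij]] := df i; have [dfj _] := df j.
pose g y := f (e *: e_ j + y) - f y.
have sh y : derivable (f \o (fun z => e *: e_ j + z)) y (e_ i) /\
    'D_(e_ i) (f \o (fun z => e *: e_ j + z)) y = 'D_(e_ i) f (e *: e_ j + y).
  have [|h1 h2] := @derive_slice R _ _ f (fun z => e *: e_ j + z) (e_ i) y (e_ i).
    by move=> h; rewrite addrCA.
  by split=> //; exact/h1.
have dg y : derivable g y (e_ i) by apply: derivableB; [exact: (sh y).1|exact: dfi].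
have [s se hs] := MVT_line x e0 dg.
have gE : 'D_(e_ i) g (s *: e_ i + x) =
    pderiv i f (e *: e_ j + (s *: e_ i + x)) - pderiv i f (s *: e_ i + x).
  rewrite deriveB; [|exact: (sh _).1|exact: dfi].
  by rewrite (sh _).2.
have [t te ht] := MVT_line (s *: e_ i + x) e0 (dfij j).1.
by exists s, t; split=> //; rewrite [LHS]hs gE ht.
Qed.

Lemma ball_two_steps x k l (a b m : R) : 0 < a -> 0 < b -> a + b < m ->
  ball x m (a *: e_ k + (b *: e_ l + x)).
Proof.
move=> a0 b0 abm; split=> [|u v]; first by rewrite (lt_trans _ abm)// addr_gt0.
rewrite -ball_normE /ball_/= !mxE; apply: le_lt_trans abm.
rewrite addrA opprD addrCA subrr addr0 normrN.
rewrite ger0_norm ?addr_ge0 ?mulr_ge0 ?ler0n ?(ltW a0) ?(ltW b0)//.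
by rewrite lerD// ler_piMr ?(ltW a0) ?(ltW b0)// lern1 leq_b1.
Qed.

(** The second difference with equal steps does not depend on the order of i and j, so the two mixed
    derivatives agree at two points close to x; both are continuous at x. *)
Lemma pderivC f i j x : Ck 2 f -> pderiv i (pderiv j f) x = pderiv j (pderiv i f) x.
Proof.
have arith3 (A B C e : R) : `|A - C| < e / 2 -> `|B - C| < e / 2 -> `|A - B| <= e.
  move=> AC BC; rewrite -(subrKA C) (le_trans (ler_normD _ _))// (splitr e).
  by rewrite lerD ?ltW// distrC.
move=> Cf; have [_ df] := Cf.
have [_ [_ /(_ i) [_ [cji _]]]] := df j.
have [_ [_ /(_ j) [_ [cij _]]]] := df i.
apply/eqP; rewrite -subr_eq0 -normr_le0; apply/ler_addgt0Pr => e e0; rewrite add0r.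
have e20 : 0 < e / 2 by rewrite divr_gt0.
have /cvgrPdist_lt /(_ _ e20) /nbhs_ballP [r1 /= r10 h1] := cij x.
have /cvgrPdist_lt /(_ _ e20) /nbhs_ballP [r2 /= r20 h2] := cji x.
(* Two steps shorter than [r] stay within both radii. *)
pose r := Num.min r1 r2 / 3.
have r0 : 0 < r by rewrite divr_gt0// lt_min r10.
have [s [t [sr tr hst]]] := second_difference i j x Cf r0.
have [s' [t' [sr' tr' hst']]] := second_difference j i x Cf r0.
have pq : pderiv j (pderiv i f) (t *: e_ j + (s *: e_ i + x)) =
          pderiv i (pderiv j f) (t' *: e_ i + (s' *: e_ j + x)).
  have arith (a b c d : R) : a - b - (c - d) = a - c - (b - d) by ring.
  move: hst hst'; rewrite (addrCA (r *: e_ i)) arith => -> /(mulfI (lt0r_neq0 r0)).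
  by move=> /(mulfI (lt0r_neq0 r0)).
have near k l (a b : R) : 0 < a < r -> 0 < b < r ->
    ball x r1 (a *: e_ k + (b *: e_ l + x)) /\ ball x r2 (a *: e_ k + (b *: e_ l + x)).
  move=> /andP[a0 ar] /andP[b0 br].
  have arith2 (m c d : R) : c < m / 3 -> d < m / 3 -> 0 < m -> c + d < m.
    by clear; lra.
  have /(arith2 _ _ _ ar br) : 0 < Num.min r1 r2 by rewrite lt_min r10.
  by rewrite lt_min => /andP[ab1 ab2]; split; exact: ball_two_steps.
have [_ p2] := near j i t s tr sr; have [p1 _] := near j i t s tr sr.
have [_ q2] := near i j t' s' tr' sr'.
have := h1 _ p1; rewrite /= pq => a; have := h2 _ q2 => /= b.
exact: (arith3 _ _ _ _ b a).
Qed.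

End smooth_functions.

(** * Functions flat at the origin *)

Section flat.
Context {R : realType}.
Implicit Types (t : R) (k : nat).

(* The functions t^-k exp(-1/t), extended by 0 to t <= 0: up to linear
   combinations they are closed under differentiation. *)
Definition flat k t : R := if 0 < t then t^-1 ^+ k * expR (- t^-1) else 0.

Lemma flat_ge0 k t : 0 <= flat k t.
Proof.
by rewrite /flat; case: ifP => // t0; rewrite mulr_ge0 ?expR_ge0// exprn_ge0// invr_ge0 ltW.
Qed.

Lemma flat_le0 k t : t <= 0 -> flat k t = 0.
Proof. by rewrite /flat; case: ltP. Qed.

(** The exponential series gives s^(k+1) / (k+1)! <= exp(s), used at s = 1/t. The bound makes
    [flat k] tend to 0 at the origin. *)
Lemma flat_bound k t : 0 < t -> flat k t <= k.+1`!%:R * t.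
Proof.
move=> t0; rewrite /flat t0 expRN ler_pdivrMr ?expR_gt0//.
have y0 : 0 <= t^-1 by rewrite invr_ge0 ltW.
have := expR_ge1Dxn k y0; move=> h.
have {h} : t^-1 ^+ k.+1 / k.+1`!%:R <= expR t^-1.
  by apply: le_trans h; rewrite lerDr.
rewrite ler_pdivrMr ?ltr0n ?fact_gt0// exprS => h.
move: h; rewrite -(@ler_pM2l _ t)// mulrA mulfV ?gt_eqF// mul1r => h.
by rewrite -mulrA mulrCA (mulrC _%:R).
Qed.

Lemma flat_mulV k t : t^-1 * flat k t = flat k.+1 t.
Proof. by rewrite /flat; case: ifP => _; rewrite ?mulr0// mulrA exprS. Qed.

(** For t > 0 this is the chain rule for y^k exp(-y) at y = 1/t. At 0 the difference quotient is
    exactly [flat k.+1], which tends to 0. *)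
Lemma is_derive_flat k t : is_derive t 1 (flat k) (flat k.+2 t - k%:R * flat k.+1 t).
Proof.
have [t0|t0|->] := ltgtP t 0.
- have h : \forall s \near t, cst 0 s = flat k s.
    by near=> s; rewrite /= flat_le0// ltW//; near: s; exact: lt_nbhsl.
  split; first by apply: near_eq_derivable h _; exact: derivable_cst.
  by rewrite -(near_eq_derive _ h) derive_cst !flat_le0 ?ltW// mulr0 subr0.
- pose G (y : R) := y ^+ k * expR (- y).
  have h : \forall s \near t, (G \o GRing.inv) s = flat k s.
    near=> s; rewrite /flat /G /=; rewrite ifT//.
    by near: s; exact: lt_nbhsr.
  have tn0 : t != 0 by rewrite gt_eqF.
  have GE : G = (fun y => y) ^+ k * (expR \o -%R).
    by apply/funext => y; rewrite /G !fctE.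
  have dG : is_derive (t^-1) 1 G
      (t^-1 ^+ k * - expR (- t^-1) + expR (- t^-1) * (k%:R * t^-1 ^+ k.-1)).
    have dE := is_derive1_comp (is_derive_expR (- t^-1)) (is_deriveNid t^-1 (1 : R)).
    have dX := is_deriveX k (is_derive_id t^-1 (1 : R)).
    rewrite GE; apply: is_derive_eq (is_deriveM dX dE) _.
    by rewrite /GRing.scale /= !fctE !mulr1 mulrN1.
  have dV : is_derive t 1 (@GRing.inv R) (- t ^- 2).
    have did : derivable id t (1 : R) by exact: derivable_id.
    have dV0 := @derivableV R _ id t 1 tn0 did.
    split; first exact: dV0.
    have := @deriveV R _ id t 1 tn0 did.
    by rewrite derive_id /GRing.scale /= mulr1.
  have d := is_derive1_comp dG dV.
  split; first by apply: near_eq_derivable h _; have [] := d.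
  rewrite -(near_eq_derive _ h); have [_ ->] := d.
  rewrite /flat t0 -exprVn.
  by case: k {G GE dG d h} => [|k] /=; rewrite ?exprS; ring.
- have dq : (h^-1 *: ((flat k \o shift 0) (h *: (1 : R)) - flat k 0)) @[h --> 0^'] --> (0 : R).
    rewrite (_ : (fun h => _) = flat k.+1); last first.
      apply/funext => h; rewrite [flat k 0]flat_le0// subr0 /= addr0.
      by rewrite (_ : h *: 1 = h); [exact: flat_mulV|exact: mulr1].
    apply/cvgrPdist_le => e e0; near=> h; rewrite sub0r normrN ger0_norm ?flat_ge0//.
    have [h0|h0] := leP h 0; first by rewrite flat_le0// ltW.
    apply: le_trans (flat_bound _ h0) _.
    rewrite mulrC -ler_pdivlMr ?ltr0n ?fact_gt0// (le_trans (ler_norm _))// ltW//.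
    by near: h; apply: dnbhs0_lt; rewrite divr_gt0// ltr0n fact_gt0.
  split; first by apply/cvg_ex; exists 0.
  by rewrite !flat_le0// mulr0 subr0; apply: cvg_lim dq.
Unshelve. all: by end_near. Qed.

End flat.

(** * Smooth bumps on boxes *)

Section bumps.
Context {R : realType} {N : nat}.
Local Notation e_ i := (delta_mx ord0 i : 'rV[R]_N).

Lemma derive_affine_coord (g : R -> R) (c d : R) (i j : 'I_N) (x : 'rV[R]_N) :
  (forall t : R, derivable g t 1) ->
  derivable (fun y : 'rV[R]_N => g (c * y ord0 i + d)) x (e_ j) /\
  'D_(e_ j) (fun y : 'rV[R]_N => g (c * y ord0 i + d)) x =
    (j == i)%:R * (c * 'D_1 g (c * x ord0 i + d)).
Proof.
move=> dg; pose w : R := (j == i)%:R * c.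
have [|h1 h2] := @derive_slice R _ R^o g (fun y : 'rV[R]_N => c * y ord0 i + d) (e_ j) x w.
  by move=> h; rewrite !mxE /= eq_sym /w /GRing.scale /= ; ring.
have /derivable1_diffP dfg := dg (c * x ord0 i + d).
split; first by apply/h1; exact: diff_derivable.
rewrite [LHS]h2 !deriveE//.
by rewrite -[w in LHS]mulr1 [LHS](linearZ_LR ('d g (c * x ord0 i + d)) w 1) /w /GRing.scale /= mulrA.
Qed.

(** The index [k] stays general in the induction on the order, because differentiation raises it by
    one or two. *)
Lemma Ck_flat m k (c d : R) (i : 'I_N) :
  Ck m (fun y : 'rV[R]_N => flat k (c * y ord0 i + d)).
Proof.
have cont k' : continuous (fun y : 'rV[R]_N => flat k' (c * y ord0 i + d)).
  move=> x; apply: (@continuous_comp _ _ _ (fun y : 'rV[R]_N => c * y ord0 i + d) (flat k')).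
    apply: (@continuousD _ _ _ (fun y : 'rV[R]_N => c * y ord0 i) (cst d)); last exact: cst_continuous.
    apply: (@continuousM _ _ (cst c) (fun y : 'rV[R]_N => y ord0 i)); first exact: cst_continuous.
    exact: coord_continuous.
  apply: differentiable_continuous; apply/derivable1_diffP.
  by have [] := is_derive_flat k' (c * x ord0 i + d).
have df k' t : derivable (@flat R k') t 1 by have [] := is_derive_flat k' t.
elim: m k => [|m ih] k; split=> // j; split=> [x|].
  by have [] := derive_affine_coord c d i j x (df k).
have -> : pderiv j (fun y : 'rV[R]_N => flat k (c * y ord0 i + d)) =
    ((j == i)%:R * c) *: ((fun y : 'rV[R]_N => flat k.+2 (c * y ord0 i + d)) +
      (- k%:R) *: (fun y : 'rV[R]_N => flat k.+1 (c * y ord0 i + d))).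
  apply/funext => x; rewrite /pderiv (derive_affine_coord c d i j x (df k)).2.
  have [_ ->] := is_derive_flat k (c * x ord0 i + d).
  by rewrite !fctE /GRing.scale /= mulrA mulNr.
by apply: CkZ; apply: CkD => //; apply: CkZ.
Qed.

Definition box_bump (n : nat) (a b : 'I_N -> R) (x : 'rV[R]_N) : R :=
  \prod_(i < N) (flat 0 (n.+1%:R * (x ord0 i - a i)) * flat 0 (n.+1%:R * (b i - x ord0 i))).

Lemma smooth_box_bump n a b : smooth (box_bump n a b).
Proof.
apply/smoothP => m; apply: Ck_prod => i.
apply: CkM.
  rewrite (_ : (fun x => _) = fun x : 'rV[R]_N => flat 0 (n.+1%:R * x ord0 i + - (n.+1%:R * a i))).
    exact: Ck_flat.
  by apply/funext => x; rewrite mulrBr.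
rewrite (_ : (fun x => _) = fun x : 'rV[R]_N => flat 0 ((- n.+1%:R) * x ord0 i + n.+1%:R * b i)).
  exact: Ck_flat.
by apply/funext => x; rewrite mulrBr addrC mulNr.
Qed.

Lemma box_bump_supp n a b x : box_bump n a b x != 0 -> rV_box a b x.
Proof.
move=> /prodf_neq0 h i; have := h i isT; rewrite mulf_eq0 negb_or => /andP[h1 h2].
apply/andP; split; rewrite -subr_gt0 -(@pmulr_rgt0 _ n.+1%:R)//.
  by rewrite ltNge; apply: contraNN h1 => h1; rewrite flat_le0.
by rewrite ltNge; apply: contraNN h2 => h2; rewrite flat_le0.
Qed.

Lemma flat0_le1 (t : R) : flat 0 t <= 1.
Proof.
rewrite /flat; case: ifP => // t0.
by rewrite expr0 mul1r -expR0 ler_expR oppr_le0 invr_ge0 ltW.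
Qed.

Lemma box_bump_ge0 n a b x : 0 <= box_bump n a b x.
Proof. by apply: prodr_ge0 => i _; rewrite mulr_ge0 ?flat_ge0. Qed.

Lemma box_bump_le1 n a b x : box_bump n a b x <= 1.
Proof. by apply: prodr_ile1 => i _; rewrite mulr_ge0 ?flat_ge0// mulr_ile1 ?flat_ge0 ?flat0_le1. Qed.

Lemma cvg_flat0 (t : R) : 0 < t -> (fun n => flat 0 (n.+1%:R * t)) @ \oo --> (1 : R).
Proof.
move=> t0.
rewrite (_ : (fun n => _) = fun n => expR (- (t^-1 * harmonic n))); last first.
  by apply/funext => n; rewrite /flat mulr_gt0// expr0 mul1r invfM mulrC.
apply: (@cvg_comp _ _ _ (fun n => - (t^-1 * harmonic n)) expR _ (nbhs (0 : R))); last first.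
  by rewrite -(expR0 R); exact: continuous_expR.
rewrite -oppr0 -(mulr0 t^-1).
exact: (cvgN (cvgM (cvg_cst t^-1) cvg_harmonic)).
Qed.

Lemma box_bump_cvg a b x : (fun n => box_bump n a b x) @ \oo --> (\1_(rV_box a b) x : R).
Proof.
have [xab|xab] := pselect (rV_box a b x); last first.
  rewrite indicE memNset// (_ : (fun n => _) = cst 0); first exact: cvg_cst.
  by apply/funext => n; apply/eqP/negPn/negP => /box_bump_supp.
rewrite indicE mem_set//= /box_bump; elim: (index_enum _) => [|i r ih].
  by under eq_fun do rewrite big_nil; exact: cvg_cst.
under eq_fun do rewrite big_cons.
have /andP[h1 h2] := xab i.
have t1 : 0 < x ord0 i - a i by rewrite subr_gt0.
have t2 : 0 < b i - x ord0 i by rewrite subr_gt0.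
by have := cvgM (cvgM (cvg_flat0 t1) (cvg_flat0 t2)) ih; rewrite !mulr1; exact.
Qed.

End bumps.

Section L2_of.
Context {d : measure_display} {X : measurableType d} {R : realType}.
Variable mu : {measure set X -> \bar R}.

(** Total in [f], so that terms carry no proof of square-integrability; the value is used only when
    [f] is square-integrable. *)
Definition L2_of (f : X -> R) : L2_space mu :=
  xget 0 [set u : L2_space mu | L2_fun u = f %[ae mu]].

Lemma L2_ofE f : f \in Lfun mu 2%:E -> L2_fun (L2_of f) = f %[ae mu].
Proof. by move=> /L2_exists[u uf]; rewrite /L2_of; case: xgetP => [v -> //|/(_ u)]. Qed.

Lemma L2_of_unique f u : f \in Lfun mu 2%:E -> L2_fun u = f %[ae mu] -> u = L2_of f.
Proof.
move=> f2 uf; apply/L2_eqP; apply: ae_eq_trans uf _; apply: ae_eq_sym; exact: L2_ofE.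
Qed.

Lemma L2_dot_of u f : f \in Lfun mu 2%:E -> L2_dot u (L2_of f) = \int[mu]_x (u x * f x).
Proof.
move=> f2; apply: ae_eq_Rintegral.
- by apply: measurable_funM; exact: L2_measurable.
- apply: measurable_funM; first exact: L2_measurable.
  by move: f2; rewrite inE => /andP[]; rewrite inE.
by apply: filterS (L2_ofE f2) => x e xT; rewrite e.
Qed.

Lemma L2_of_lin a f g : f \in Lfun mu 2%:E -> g \in Lfun mu 2%:E ->
  (a *: f + g) \in Lfun mu 2%:E -> L2_of (a *: f + g) = a *: L2_of f + L2_of g.
Proof.
move=> f2 g2 h2; apply/esym/L2_of_unique => //.
have := L2_addE (a *: L2_of f) (L2_of g); have := L2_scaleE a (L2_of f).
have := L2_ofE f2; have := L2_ofE g2.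
move=> H1 H2 H3 H4.
have K : \forall x \ae mu, L2_of g x = g x /\ L2_of f x = f x.
  by move: H1 H2; apply: filterS2 => x e1 e2; split; [exact: e1|exact: e2].
move: K H3 H4; apply: filterS3 => x [e1 e2] e3 e4 xT.
by rewrite e4// e3// e2 e1.
Qed.

End L2_of.

(** * Test functions *)

Section test_functions_theory.
Context {R : realType} {N : nat}.
Variable Omega : domain R N.
Local Notation vol := (volume Omega).
Local Notation test := (test_function Omega).
Local Notation leb := (lebesgue_rV R N).
Implicit Types f g : 'rV[R]_N -> R.
Local Notation supp f := (closure [set x | f x != 0]).

Lemma test_smooth f : test f -> smooth f. Proof. by case. Qed.

Lemma test_derivable f i x : test f -> derivable f x (delta_mx ord0 i).
Proof. by move=> /test_smooth; exact: smooth_derivable. Qed.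

Lemma test_eq0 f x : test f -> ~ dom_set Omega x -> f x = 0.
Proof.
move=> [_ _ sO] nO; apply/eqP/negPn/negP => fx; apply: nO; apply: sO.
exact: subset_closure.
Qed.

Lemma test_of_supp f g : test f -> smooth g ->
  [set x | g x != 0] `<=` supp f -> test g.
Proof.
move=> [_ cf sf] sg gf; have scf : supp g `<=` supp f.
  apply: subset_trans (closure_subset gf) _.
  by rewrite -(proj1 (closure_id _))//; exact: closed_closure.
split=> //; last exact: subset_trans sf.
by apply: subclosed_compact scf; [exact: closed_closure|].
Qed.

Lemma test_pderiv f i : test f -> test (pderiv i f).
Proof.
move=> tf; apply: (test_of_supp tf); first exact: (smooth_pderivs [:: i] (test_smooth tf)).
move=> x /= /negP fx; apply: contrapT => nx; apply: fx; apply/eqP.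
have f0 : \forall y \near x, f y = cst 0 y.
  have : nbhs x (~` supp f).
    by apply: open_nbhs_nbhs; split=> //; apply: closed_openC; exact: closed_closure.
  apply: filterS => y ny; apply/eqP/negPn/negP => fy; apply: ny.
  exact: subset_closure.
by rewrite /pderiv (near_eq_derive _ f0) derive_cst.
Qed.

Lemma test_pderivs f s : test f -> test (pderivs s f).
Proof. by move=> tf; elim: s => //= i s ih; exact: test_pderiv. Qed.

Lemma test_lin a f g : test f -> test g -> test (a *: f + g).
Proof.
move=> [sf cf fO] [sg cg gO]; split; first exact: smoothP_lin.
all: have sub : supp (a *: f + g) `<=` supp f `|` supp g.
1,3: rewrite -closureU; apply: closure_subset => x /= h.
1,2: have [f0|f0] := eqVneq (f x) 0; last by left.
1,2: by right; move: h; rewrite !fctE f0 scaler0 add0r.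
  by apply: subclosed_compact sub; [exact: closed_closure|exact: compactU].
by apply: subset_trans sub _ => x [/fO|/gO].
Qed.

Lemma test0 : test (cst 0).
Proof.
have s0 : [set x : 'rV[R]_N | (cst 0 x : R) != 0] = set0.
  by apply/seteqP; split => x //=; rewrite eqxx.
split; last 2 first.
- by rewrite s0 closure0; exact: compact0.
- by rewrite s0 closure0.
by apply/smoothP => m; exact: Ck_cst.
Qed.

Lemma test_cbs f : test f -> cbs f.
Proof.
move=> [sf cf sO]; have cont := smooth_continuous sf; split=> //.
have [M1 [_ b1]] := compact_bounded cf.
have cfK : compact (f @` supp f).
  by apply: continuous_compact => //; exact: continuous_subspaceT.
have [M2 [_ b2]] := compact_bounded cfK.
pose M := Num.max 1 (Num.max (M1 + 1) (M2 + 1)).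
have M1M : M1 < M by rewrite !lt_max ltrDl ltr01 !orbT.
have M2M : M2 < M by rewrite !lt_max ltrDl ltr01 !orbT.
(* Compactness yields |x| <= M on the support; the extra 1 places these points in an open box. *)
exists (M + 1) => x; have [->|fx] := eqVneq (f x) 0.
  by rewrite normr0; split=> //; rewrite addr_ge0// le_max ler01.
have xs : supp f x by exact: subset_closure.
split=> [|_ i].
  have /= := b2 _ M2M _ (imageP f xs); move/le_trans; apply; by rewrite lerDl.
have /= xM := b1 _ M1M _ xs.
have : `|x ord0 i| < M + 1.
  rewrite (le_lt_trans _ (_ : M < M + 1))// ?ltrDl//; apply: le_trans xM.
  have -> : `|x| = mx_norm x by [].
  by rewrite mx_normrE; exact: (le_bigmax _ (fun k : 'I_1 * 'I_N => `|x k.1 k.2|) (ord0, i)).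
by rewrite ltr_norml.
Qed.

Lemma cbsM f g : cbs f -> cbs g -> cbs (f * g).
Proof.
move=> [cf [M fM]] [cg [M' gM]]; split; first by move=> x; exact: cvgM (cf x) (cg x).
have M0 : 0 <= M by apply: le_trans (fM 0).1; rewrite normr_ge0.
have M'0 : 0 <= M' by apply: le_trans (gM 0).1; rewrite normr_ge0.
exists (M + M * M') => x; have [f1 f2] := fM x; have [g1 _] := gM x; split.
  by rewrite normrM (le_trans (ler_pM _ _ f1 g1))// lerDr.
rewrite mulf_eq0 negb_or => /andP[/f2 h _] i; have /andP[h1 h2] := h i.
have MM : 0 <= M * M' by rewrite mulr_ge0.
by apply/andP; split; [rewrite (le_lt_trans _ h1)// lerN2 lerDl|rewrite (lt_le_trans h2)// lerDl].
Qed.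

Lemma cbs_Lfun f : cbs f -> (f : 'rV[R]_N -> R) \in Lfun vol 2%:E.
Proof.
move=> cf; have mf := continuous_measurable_rV cf.1.
have mf2 : measurable_fun setT (fun x => (f x ^+ 2)%:E) by exact/measurable_EFinP/measurable_funX.
apply: sqr_integrable_Lfun => //.
rewrite [X in (X < _)%E](@ge0_integral_mrestr _ _ _ leb)//; last first.
  by move=> x; rewrite lee_fin sqr_ge0.
have /integrableP[_] := cbs_integrable (cbsM cf cf); apply: le_lt_trans.
rewrite integral_mkcond; apply: ge0_le_integral => //.
- by move=> x _; apply: erestrict_ge0 => y _; rewrite lee_fin sqr_ge0.
- apply/(measurable_restrict _ (open_measurable_rV (dom_open Omega)) measurableT).
  by rewrite setTI; exact: measurable_funTS.
- by apply: measurableT_comp => //; exact: mf2.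
- move=> x _; rewrite patchE; case: ifP => _; last by rewrite abse_ge0.
  by rewrite /= lee_fin expr2 ler_norm.
Qed.

Lemma test_Lfun f : test f -> (f : 'rV[R]_N -> R) \in Lfun vol 2%:E.
Proof. by move=> /test_cbs; exact: cbs_Lfun. Qed.

Lemma volume_Rintegral f : continuous f -> (forall x, ~ dom_set Omega x -> f x = 0) ->
  \int[vol]_x f x = \int[leb]_x f x.
Proof.
move=> cf f0; congr fine; apply: integral_mrestr_supp.
  by apply/measurable_EFinP; apply: continuous_measurable_rV.
by move=> x /f0 ->.
Qed.

(** Both products vanish off [Omega], so the integrals may be taken over R^N, where their sum is the
    integral of the i-th derivative of f g. *)
Lemma integration_by_parts_test f g i : test f -> test g ->
  \int[vol]_x (pderiv i f x * g x) = - \int[vol]_x (f x * pderiv i g x).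
Proof.
move=> tf tg; have tf' := test_pderiv i tf; have tg' := test_pderiv i tg.
have [cf cg cf' cg'] : [/\ cbs f, cbs g, cbs (pderiv i f) & cbs (pderiv i g)].
  by split; exact: test_cbs.
have c1 := cbsM cf' cg; have c2 := cbsM cf cg'.
rewrite !volume_Rintegral; first last.
- by move=> x nO; rewrite (test_eq0 tf')// mul0r.
- exact: c1.1.
- by move=> x nO; rewrite (test_eq0 tf)// mul0r.
- exact: c2.1.
apply/eqP; rewrite -addr_eq0; apply/eqP.
have pE : pderiv i (f * g) = (fun x => pderiv i f x * g x + f x * pderiv i g x).
  rewrite pderivM; try by move=> x; exact: test_derivable.
  by apply/funext => x; rewrite !fctE addrC mulrC.
rewrite -RintegralD//; [|exact: cbs_integrable c1|exact: cbs_integrable c2].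
have cp : cbs (pderiv i (f * g)).
  have [c1c [M1 h1]] := c1; have [c2c [M2 h2]] := c2; rewrite pE; split.
    by move=> x; exact: cvgD (c1c x) (c2c x).
  have M10 : 0 <= M1 by apply: le_trans (h1 0).1; rewrite normr_ge0.
  have M20 : 0 <= M2 by apply: le_trans (h2 0).1; rewrite normr_ge0.
  exists (M1 + M2) => x; have [a1 b1] := h1 x; have [a2 b2] := h2 x; split.
    by rewrite (le_trans (ler_normD _ _))// lerD.
  have [e1|e1] := eqVneq ((pderiv i f * g) x) 0.
    move=> ne; have /b2 h : (f * pderiv i g) x != 0 by move: ne e1; rewrite !fctE => ne e1; rewrite e1 add0r in ne.
    move=> k; have /andP[k1 k2] := h k.
    by apply/andP; split; [rewrite (le_lt_trans _ k1)// lerN2 lerDr|rewrite (lt_le_trans k2)// lerDr].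
  move=> _ k; have /andP[k1 k2] := b1 e1 k.
  by apply/andP; split; [rewrite (le_lt_trans _ k1)// lerN2 lerDl|rewrite (lt_le_trans k2)// lerDl].
have := integral_pderiv (cbsM cf cg) _ cp; rewrite pE /Rintegral => ->//.
by move=> x; apply: derivableM; exact: test_derivable.
Qed.

End test_functions_theory.

Lemma L2_0E d (X : measurableType d) (R : realType) (mu : {measure set X -> \bar R}) :
  L2_fun (0 : L2_space mu) = cst 0 %[ae mu].
Proof.
have := L2_scaleE 0 (0 : L2_space mu); rewrite scale0r.
by apply: filterS => x h xT; rewrite h// mul0r.
Qed.

(** * Test functions separate the elements of L^2 *)

Section density.
Context {R : realType} {N : nat}.
Implicit Types a b : 'I_N -> R.

Definition rV_cbox a b : set 'rV[R]_N := [set x | forall i, a i <= x ord0 i <= b i].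

Lemma rV_boxI a b a' b' : rV_box a b `&` rV_box a' b' =
  rV_box (fun i => Num.max (a i) (a' i)) (fun i => Num.min (b i) (b' i)).
Proof.
apply/seteqP; split=> [x [h1 h2] i|x h].
  by have /andP[? ?] := h1 i; have /andP[? ?] := h2 i; rewrite gt_max lt_min; apply/andP; split; apply/andP.
by split=> i; have := h i; rewrite gt_max lt_min => /andP[/andP[? ?] /andP[? ?]]; apply/andP.
Qed.

Lemma rV_cbox_compact a b : compact (rV_cbox a b).
Proof.
have := @rV_compact R N (fun i => `[a i, b i]%classic) (fun i => @segment_compact R (a i) (b i)).
congr compact; apply/seteqP; split=> x /= h i; have := h i; by rewrite /= in_itv.
Qed.

Lemma closure_rV_box a b : closure (rV_box a b) `<=` rV_cbox a b.
Proof.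
have cb : closed (rV_cbox a b).
  by apply: (compact_closed (@norm_hausdorff _ _)); exact: rV_cbox_compact.
rewrite [X in _ `<=` X](proj1 (closure_id _) cb); apply: closure_subset => x h i.
by have /andP[h1 h2] := h i; rewrite !ltW.
Qed.

Lemma test_box_bump (Omega : domain R N) n a b : rV_cbox a b `<=` Omega ->
  test_function Omega (box_bump n a b).
Proof.
move=> abO; have sub : closure [set x | box_bump n a b x != 0] `<=` rV_cbox a b.
  apply: subset_trans (@closure_rV_box a b); apply: closure_subset => x /=.
  exact: box_bump_supp.
split; [exact: smooth_box_bump| |exact: subset_trans sub abO].
by apply: subclosed_compact sub; [exact: closed_closure|exact: rV_cbox_compact].
Qed.

(** Boxes are stable under intersection; that they also generate the sigma-algebra permits a Dynkin
    induction starting from them. *)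
Lemma measurable_rV_boxes :
  @measurable _ 'rV[R]_N = <<s [set rV_box ab.1 ab.2 | ab in [set: ('I_N -> R) * ('I_N -> R)]] >>.
Proof.
set G := [set _ | _ in _]; apply/seteqP; split; last first.
  apply: smallest_sub; first exact: sigma_algebra_measurable.
  by move=> _ [[a b] _ <-]; exact: measurable_rV_box.
have mG i : measurable_fun setT (rV_coord i : g_sigma_algebraType G -> R).
  apply: (measurability _ (RGenOInfty.measurableE R)) => //.
  move=> _ [_ [c ->] <-]; rewrite setTI.
  (* A half space {x_i > c} is exhausted by boxes with lower bound c in coordinate i, every other
     bound being -n or n. *)
  rewrite (_ : _ @^-1` _ = \bigcup_n rV_box
      (fun j => if j == i then c else - n%:R) (fun=> n%:R : R)).
    apply: bigcupT_measurable => n; apply: sub_sigma_algebra => /=.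
    by exists ((fun j => if j == i then c else - n%:R), (fun=> n%:R : R)).
  apply/seteqP; split=> [x /=|x [n _ /(_ i)]]; last first.
    by rewrite eqxx /= in_itv/= => /andP[->].
  rewrite in_itv/= andbT => cx.
  exists (\max_(j < N) (Num.truncn `|x ord0 j|).+1)%N => // j.
  have : `|x ord0 j| < (\max_(j < N) (Num.truncn `|x ord0 j|).+1)%N%:R.
    apply: lt_le_trans (truncnS_gt _) _; rewrite ler_nat.
    exact: (@leq_bigmax _ (fun j : 'I_N => (Num.truncn `|x ord0 j|).+1) j).
  rewrite ltr_norml => /andP[h1 h2]; rewrite h2 andbT.
  by case: eqP => [->|].
apply: smallest_sub; first exact: smallest_sigma_algebra.
move=> A /=; rewrite -bigcup_seq/= => -[i _ [Y mY <-]].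
exact: mG.
Qed.

Variable Omega : domain R N.
Local Notation vol := (volume Omega).

Lemma volume_box_lty a b : (vol (rV_box a b) < +oo)%E.
Proof.
apply: le_lt_trans (lebesgue_rV_box_lty a b).
have mB := measurable_rV_box a b; have mO := open_measurable_rV (dom_open Omega).
rewrite [X in (X <= _)%E](_ : _ = lebesgue_rV R N (rV_box a b `&` Omega))//.
by apply: le_measure; rewrite ?inE//; exact: measurableI.
Qed.

Lemma indic_box_Lfun a b : (\1_(rV_box a b) : _ -> R) \in Lfun vol 2%:E.
Proof.
have mB := measurable_rV_box a b.
apply: sqr_integrable_Lfun; first exact: measurable_indic.
rewrite (eq_integral (fun x => (\1_(rV_box a b) x)%:E)); last first.
  by move=> x _; rewrite indicE; case: (_ \in _); rewrite ?expr1n ?expr0n.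
by rewrite integral_indic// setIT volume_box_lty.
Qed.

(** Dominated convergence along the bumps: they lie between 0 and 1 and vanish off the box, so |u|
    times the indicator dominates. It is integrable because the box has finite volume. *)
Lemma box_integral_eq0 (u : L2 Omega) a b :
  (forall phi, test_function Omega phi -> \int[vol]_x (u x * phi x) = 0) ->
  rV_cbox a b `<=` Omega ->
  (\int[vol]_(x in rV_box a b) (u x)%:E = 0)%E.
Proof.
move=> u0 abO; have mB := measurable_rV_box a b.
have mu_ := L2_measurable u.
pose w x := u x * \1_(rV_box a b) x.
have iw : vol.-integrable setT (EFin \o w).
  by apply/Lfun1_integrable/Lfun2_mul_Lfun1; [exact: L2_fun_Lfun|exact: indic_box_Lfun].
have mb n : measurable_fun setT (box_bump n a b).
  by apply: continuous_measurable_rV; apply: smooth_continuous; exact: smooth_box_bump.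
have [|||||_ _] := @dominated_convergence _ _ _ vol setT measurableT
  (fun n x => (u x * box_bump n a b x)%:E) (EFin \o w) (fun x => `|w x|%:E).
- by move=> n; apply/measurable_EFinP; exact: measurable_funM.
- exact: (measurable_int _ iw).
- apply: aeW => x _; apply: cvg_EFin; first exact: nearW.
  have h : (u x * box_bump n a b x) @[n --> \oo] --> w x.
    by apply: cvgM; [exact: cvg_cst|exact: box_bump_cvg].
  exact: h.
- exact: (integrable_abse iw).
- apply: aeW => x n _; rewrite lee_fin /w !normrM ler_wpM2l//.
  rewrite ger0_norm ?box_bump_ge0// indicE.
  have [->|/box_bump_supp bx] := eqVneq (box_bump n a b x) 0; first exact: normr_ge0.
  by rewrite mem_set//= normr1 box_bump_le1.
rewrite [X in X @ _ --> _](_ : _ = cst 0%E); last first.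
  apply/funext => n /=.
  have tb := test_box_bump n abO.
  have := u0 _ tb; rewrite /Rintegral => h.
  rewrite -[LHS]fineK ?h//; apply: integrable_fin_num => //.
  by apply/Lfun1_integrable/Lfun2_mul_Lfun1; [exact: L2_fun_Lfun|exact: test_Lfun tb].
move=> h; have := cvg_unique _ h (cvg_cst _) => {}h.
rewrite integral_mkcond -[RHS]h; last exact: ereal_hausdorff.
apply: eq_integral => x _; rewrite patchE /= /w indicE; case: ifP => _; rewrite ?mulr1 ?mulr0//.
Qed.

(** The measurable sets over which u times the indicator of the box has integral 0 form a Dynkin
    system. It contains all boxes, since intersecting with the given box leaves a box whose
    [rV_cbox] is still inside [Omega]. An integrable function whose integrals all vanish is 0 almost
    everywhere. *)
Lemma box_ae_eq0 (u : L2 Omega) a b :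
  (forall phi, test_function Omega phi -> \int[vol]_x (u x * phi x) = 0) ->
  rV_cbox a b `<=` Omega ->
  {ae vol, forall x, rV_box a b x -> u x = 0}.
Proof.
move=> u0 abO; have mB := measurable_rV_box a b.
pose w x := u x * \1_(rV_box a b) x.
have iw : vol.-integrable setT (EFin \o w).
  by apply/Lfun1_integrable/Lfun2_mul_Lfun1; [exact: L2_fun_Lfun|exact: indic_box_Lfun].
have wE A : (\int[vol]_(x in A) (w x)%:E = \int[vol]_(x in A `&` rV_box a b) (u x)%:E)%E.
  rewrite integral_mkcondr; apply: eq_integral => x _.
  by rewrite patchE /w indicE; case: ifP; rewrite ?mulr1 ?mulr0.
have w0 A : measurable A -> (\int[vol]_(x in A) (w x)%:E = 0)%E.
  rewrite measurable_rV_boxes.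
  move: A; apply: (dynkin_induction (P := fun A => (\int[vol]_(x in A) (w x)%:E = 0)%E)
    measurable_rV_boxes).
  - by move=> _ _ [[a1 b1] _ <-] [[a2 b2] _ <-]; rewrite rV_boxI; eexists (_, _).
  - by rewrite wE setTI box_integral_eq0.
  - move=> _ [[a1 b1] _ <-]; rewrite wE rV_boxI box_integral_eq0// => x h.
    apply: abO => i; have := h i; rewrite ge_max le_min /=.
    by move=> /andP[/andP[_ ->] /andP[_ ->]].
  - move=> S mS S0.
    have iS B : measurable B -> vol.-integrable B (EFin \o w).
      by move=> mB'; apply: integrableS iw.
    have : (\int[vol]_(x in S `|` ~` S) (w x)%:E = 0)%E.
      by rewrite setUv wE setTI box_integral_eq0.
    rewrite integral_setU//; first by rewrite S0 add0e.
    + exact: measurableC.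
    + by rewrite setUv; exact: measurable_int iw.
    + by apply/disj_setPS; rewrite setICr.
  - move=> F mF tF F0; rewrite integral_bigcup//.
      by apply: eseries0 => i _ _; exact: F0.
    by apply: integrableS iw => //; exact: bigcupT_measurable.
have := @integral_ae_eq _ _ _ vol setT measurableT (cst 0%E) (EFin \o w) iw.
move=> /(_ (measurable_cst _)) []; first by move=> A _ mA; rewrite w0// integral0.
move=> A hA; exists A; case: hA => h1 h2 h3; split=> //.
apply: subset_trans h3 => x /= nx hx; apply: nx => xB.
by have [] := hx I; rewrite /w indicE mem_set//= mulr1.
Qed.

(** [Omega] is covered by the rational cubes whose closed versions it contains, and there are only
    countably many of them. *)
Lemma test_separating (u : L2 Omega) :
  (forall phi, test_function Omega phi -> \int[vol]_x (u x * phi x) = 0) -> u = 0.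
Proof.
move=> u0; apply/L2_eqP.
have O_ae : {ae vol, forall x, dom_set Omega x}.
  exists (~` Omega); split=> //.
    by apply: measurableC; exact: open_measurable_rV (dom_open Omega).
  by rewrite /volume /= /mrestr setICl measure0.
pose B (c : 'rV[rat]_N * nat) := (fun i => ratr (c.1 ord0 i) - c.2.+1%:R^-1 : R,
                                  fun i => ratr (c.1 ord0 i) + c.2.+1%:R^-1 : R).
(* Enumerating the cubes through [unpickle] lets one null set serve for all of them. *)
have : {ae vol, forall x, forall n : nat, forall c, unpickle n = Some c ->
    rV_cbox (B c).1 (B c).2 `<=` Omega -> rV_box (B c).1 (B c).2 x -> u x = 0}.
  apply: ae_foralln => n; case: (unpickle n) => [c|]; last by apply: aeW => x c.
  have [cO|ncO] := pselect (rV_cbox (B c).1 (B c).2 `<=` Omega).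
    by apply: filterS (box_ae_eq0 u0 cO) => x h _ [<-].
  by apply: aeW => x _ [<-].
move: O_ae (L2_0E vol); apply: filterS3 => x Ox z h _; rewrite z//=.
suff [c cO cx] : exists2 c, rV_cbox (B c).1 (B c).2 `<=` Omega & rV_box (B c).1 (B c).2 x.
  exact: (h (pickle c) c (pickleK c) cO cx).
have /nbhs_ballP[e /= e0 eA] : nbhs x (dom_set Omega) by have := dom_open Omega; rewrite openE; exact.
pose k := Num.truncn (2 / e).
have ke : k.+1%:R^-1 < e / 2 :> R.
  rewrite -[ltRHS]invrK ltf_pV2 ?posrE ?invr_gt0 ?divr_gt0//.
  by rewrite invf_div truncnS_gt// divr_ge0// ltW.
have k0 : 0 < k.+1%:R^-1 :> R by rewrite invr_gt0.
have /(_ _)/cid-/all_sig[q qP] : forall i : 'I_N, exists q : rat,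
    `|x ord0 i - ratr q| < k.+1%:R^-1.
  move=> i.
  have /rat_in_itvoo[q] : x ord0 i < x ord0 i + k.+1%:R^-1 by rewrite ltrDl.
  rewrite in_itv/= => /andP[q1 q2]; exists q.
  by rewrite distrC ger0_norm ?subr_ge0 1?ltW// ltrBlDl.
exists (\row_i q i, k) => /=.
  move=> y yB; apply: eA; split=> // i j; rewrite (ord1 i) -ball_normE /ball_/=.
  have := yB j; rewrite mxE => /andP[y1 y2]; have := qP j; rewrite ltr_norml => /andP[x1 x2].
  move: (k.+1%:R^-1) ke y1 y2 x1 x2 => r ke y1 y2 x1 x2.
  by rewrite ltr_norml; apply/andP; split; lra.
move=> i; rewrite /= mxE; have := qP i; rewrite ltr_norml => /andP[x1 x2].
by move: (k.+1%:R^-1) x1 x2 => r x1 x2; apply/andP; split; lra.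
Qed.

End density.

(** * Weak derivatives *)

Section weak_derivatives.
Context {R : realType} {N : nat}.
Variable Omega : domain R N.
Local Notation vol := (volume Omega).
Local Notation test := (test_function Omega).
Local Notation E := (L2 Omega).
Local Notation cl := (L2_of vol).
Implicit Types (u v w : E) (f g phi psi : 'rV[R]_N -> R) (s : seq 'I_N).

Lemma test_classP u : test_class Omega u <-> exists2 phi, test phi & u = (cl phi).
Proof.
split=> [[phi tp up]|[phi tp ->]]; exists phi => //.
  by apply: L2_of_unique => //; exact: test_Lfun.
exact: L2_ofE (test_Lfun tp).
Qed.

Lemma L2_dot_test u phi : test phi -> \int[vol]_x (u x * phi x) = L2_dot u (cl phi).
Proof. by move=> tp; rewrite L2_dot_of//; exact: test_Lfun. Qed.

Lemma L2_of_test_lin a phi psi : test phi -> test psi ->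
  (cl (a *: phi + psi)) = a *: (cl phi) + (cl psi).
Proof. by move=> tp ts; apply: L2_of_lin; apply: test_Lfun => //; exact: test_lin. Qed.

Lemma L2_of_test0 : (cl (cst 0)) = 0.
Proof. by apply/esym/L2_of_unique; [exact: test_Lfun (test0 _)|exact: L2_0E]. Qed.

Lemma test_sum (I : Type) (r : seq I) (F : I -> 'rV[R]_N -> R) :
  (forall i, test (F i)) -> test (fun x => \sum_(i <- r) F i x) /\
  (cl (fun x => \sum_(i <- r) F i x)) = \sum_(i <- r) (cl (F i)).
Proof.
move=> tF; elim: r => [|i r [ih1 ih2]].
  rewrite (_ : (fun x => _) = cst 0); last by apply/funext => x; rewrite big_nil.
  by rewrite big_nil L2_of_test0; split=> //; exact: test0.
rewrite (_ : (fun x => _) = 1 *: F i + (fun x => \sum_(j <- r) F j x)); last first.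
  by apply/funext => x; rewrite big_cons !fctE scale1r.
by split; [exact: test_lin|rewrite L2_of_test_lin// scale1r big_cons ih2].
Qed.

Lemma test_Delta phi : test phi -> test (Delta phi).
Proof. by move=> tp; have [] := test_sum (index_enum _) (fun i => test_pderivs [:: i; i] tp). Qed.

Lemma L2_of_Delta phi : test phi -> (cl (Delta phi)) = \sum_(i < N) (cl (pderivs [:: i; i] phi)).
Proof. by move=> tp; have [] := test_sum (index_enum _) (fun i => test_pderivs [:: i; i] tp). Qed.

Lemma Delta_lin a phi psi : test phi -> test psi ->
  Delta (a *: phi + psi) = a *: Delta phi + Delta psi.
Proof.
move=> tp ts; apply/funext => x.
rewrite /Delta [RHS](_ : _ = a *: (\sum_(i < N) pderivs [:: i; i] phi x) +
  \sum_(i < N) pderivs [:: i; i] psi x)//.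
rewrite scaler_sumr -big_split; apply: eq_bigr => i _.
by rewrite (pderivsP [:: i; i] a (test_smooth tp) (test_smooth ts)).
Qed.

(** Source of the uniqueness of weak derivatives and weak Laplacians, through which the [xget] in
    [wderivs] and [laplacian] is evaluated. *)
Lemma L2_eq_test u v : (forall phi, test phi -> L2_dot u (cl phi) = L2_dot v (cl phi)) -> u = v.
Proof.
move=> uv; apply/eqP; rewrite -subr_eq0; apply/eqP; apply: test_separating => phi tp.
by rewrite L2_dot_test// L2_dotBl uv// subrr.
Qed.

(** Written with scalar products, the defining identity can be passed to the limit by the
    Cauchy-Schwarz inequality. *)
Lemma is_wderivsP s u v : is_wderivs s u v <->
  forall phi, test phi -> L2_dot u (cl (pderivs s phi)) = (-1) ^+ size s * L2_dot v (cl phi).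
Proof.
by split=> h phi tp; have := h phi tp; rewrite !L2_dot_test//; exact: test_pderivs.
Qed.

Lemma is_laplacianP u v : is_laplacian u v <->
  forall phi, test phi -> L2_dot u (cl (Delta phi)) = L2_dot v (cl phi).
Proof. by split=> h phi tp; have := h phi tp; rewrite !L2_dot_test//; exact: test_Delta. Qed.

Lemma wderivsE s u v : is_wderivs s u v -> wderivs s u = v.
Proof.
move=> uv; rewrite /wderivs; case: xgetP => [w _ uw|/(_ v)//].
apply: L2_eq_test => phi tp.
move/is_wderivsP : uv => /(_ _ tp); move/is_wderivsP : uw => /(_ _ tp) -> /(mulrI _); apply.
by rewrite unitrX// unitrN1.
Qed.

Lemma laplacianE u v : is_laplacian u v -> laplacian u = v.
Proof.
move=> uv; rewrite /laplacian; case: xgetP => [w _ uw|/(_ v)//].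
apply: L2_eq_test => phi tp.
by move/is_laplacianP : uv => /(_ _ tp) <-; move/is_laplacianP : uw => /(_ _ tp) <-.
Qed.

Lemma laplacianP u : H_Delta Omega u -> is_laplacian u (laplacian u).
Proof. by move=> [v uv]; rewrite (laplacianE uv). Qed.

Lemma is_wderivs_lin s a u v u' v' : is_wderivs s u v -> is_wderivs s u' v' ->
  is_wderivs s (a *: u + u') (a *: v + v').
Proof.
move=> /is_wderivsP uv /is_wderivsP uv'; apply/is_wderivsP => phi tp.
by rewrite !L2_dotPl uv// uv'//; ring.
Qed.

Lemma is_laplacian_lin a u v u' v' : is_laplacian u v -> is_laplacian u' v' ->
  is_laplacian (a *: u + u') (a *: v + v').
Proof.
move=> /is_laplacianP uv /is_laplacianP uv'; apply/is_laplacianP => phi tp.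
by rewrite !L2_dotPl uv// uv'.
Qed.

Lemma is_laplacian0 : is_laplacian (0 : E) 0.
Proof. by apply/is_laplacianP => phi tp; rewrite !L2_dot0l. Qed.

Lemma is_wderivs0 s : is_wderivs s (0 : E) 0.
Proof. by apply/is_wderivsP => phi tp; rewrite !L2_dot0l mulr0. Qed.

Lemma dot_pderiv i phi psi : test phi -> test psi ->
  L2_dot (cl (pderiv i phi)) (cl psi) = - L2_dot (cl phi) (cl (pderiv i psi)).
Proof.
move=> tp ts; have tp' := test_pderiv i tp; have ts' := test_pderiv i ts.
have := integration_by_parts_test i tp ts.
have dotE f g : test f -> test g -> L2_dot (cl f) (cl g) = \int[vol]_x (f x * g x).
  move=> tf tg; rewrite L2_dot_of; last exact: test_Lfun.
  apply: ae_eq_Rintegral.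
  - apply: measurable_funM; first exact: L2_measurable.
    exact: continuous_measurable_rV (test_cbs tg).1.
  - by apply: measurable_funM; apply: continuous_measurable_rV; [have [] := test_cbs tf|have [] := test_cbs tg].
  by apply: filterS (L2_ofE (test_Lfun tf)) => x e xT; rewrite e.
by rewrite !dotE.
Qed.

(** Integration by parts removes the outermost derivative of the test function, and this one becomes
    the innermost on phi. The [rev] records the order, so that no derivatives have to be
    commuted. *)
Lemma is_wderivs_test s phi : test phi -> is_wderivs s (cl phi) (cl (pderivs (rev s) phi)).
Proof.
move=> tp; apply/is_wderivsP => psi ts.
elim: s phi tp => [|i s ih] phi tp; first by rewrite expr0 mul1r.
have := dot_pderiv i tp (test_pderivs s ts) => /(congr1 -%R); rewrite opprK => /esym h.
rewrite /= in h *; rewrite h ih; last exact: test_pderiv.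
by rewrite exprS mulN1r mulNr rev_cons pderivs_rcons.
Qed.

Lemma L2_dot_sumr (I : Type) (r : seq I) w (F : I -> E) :
  L2_dot w (\sum_(i <- r) F i) = \sum_(i <- r) L2_dot w (F i).
Proof. exact: (big_morph (fun u => L2_dot w u) (fun u v => L2_dotDr u v w) (L2_dot0r w)). Qed.

Lemma L2_dot_suml (I : Type) (r : seq I) w (F : I -> E) :
  L2_dot (\sum_(i <- r) F i) w = \sum_(i <- r) L2_dot (F i) w.
Proof. exact: (big_morph (fun u => L2_dot u w) (fun u v => L2_dotDl u v w) (L2_dot0l w)). Qed.

Lemma sum_L2_dotC (I : Type) (r : seq I) (F G : I -> E) :
  \sum_(i <- r) L2_dot (F i) (G i) = \sum_(i <- r) L2_dot (G i) (F i).
Proof. by apply: eq_bigr => i _; rewrite L2_dotC. Qed.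

Lemma L2_dot_sum_opp w (F G H : 'I_N -> E) :
  (forall i, L2_dot (G i) (H i) = - L2_dot w (F i)) ->
  L2_dot w (\sum_(i < N) F i) = - \sum_(i < N) L2_dot (G i) (H i).
Proof.
by move=> h; rewrite L2_dot_sumr -sumrN; apply: eq_bigr => i _; rewrite h opprK.
Qed.

Lemma L2_norm_sum (F : 'I_N -> E) (G : 'I_N -> 'I_N -> E) :
  (forall i j, L2_dot (G i j) (G i j) = L2_dot (F i) (F j)) ->
  \sum_(i < N) \sum_(j < N) `|G i j| ^+ 2 = `|\sum_(i < N) F i| ^+ 2.
Proof.
move=> h; rewrite -L2_dot_norm L2_dot_suml; apply: eq_bigr => i _.
by rewrite L2_dot_sumr; apply: eq_bigr => j _; rewrite -h L2_dot_norm.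
Qed.

Lemma dot_Delta phi psi : test phi -> test psi ->
  L2_dot (cl phi) (cl (Delta psi)) =
  - \sum_(i < N) L2_dot (cl (pderiv i phi)) (cl (pderiv i psi)).
Proof.
move=> tp ts; rewrite (L2_of_Delta ts).
by apply: L2_dot_sum_opp => i; exact: (dot_pderiv i tp (test_pderiv i ts)).
Qed.

(** Both sides equal minus the scalar product of the gradients, which is symmetric in the two test
    functions. *)
Lemma is_laplacian_test phi : test phi -> is_laplacian (cl phi) (cl (Delta phi)).
Proof.
move=> tp; apply/is_laplacianP => psi ts.
have e1 := dot_Delta tp ts; have e2 := dot_Delta ts tp.
have e3 := congr1 -%R (sum_L2_dotC (index_enum 'I_N) (fun i => cl (pderiv i phi))
  (fun i => cl (pderiv i psi))).
have e4 := L2_dotC (cl psi) (cl (Delta phi)).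
exact: etrans e1 (etrans e3 (etrans (esym e2) e4)).
Qed.

Lemma triple_pderivC phi i j : smooth phi ->
  pderiv i (pderiv i (pderiv j phi)) = pderiv j (pderiv i (pderiv i phi)).
Proof.
move=> sp.
have C2 psi : smooth psi -> Ck 2 psi by move=> /smoothP; exact.
have -> : pderiv i (pderiv j phi) = pderiv j (pderiv i phi).
  by apply/funext => x; exact: pderivC (C2 _ sp).
by apply/funext => x; apply: pderivC; apply: C2; exact: (smooth_pderivs [:: i]).
Qed.

(* Two integrations by parts exchange the derivatives:
   <d_i d_j phi, d_i d_j phi> = <d_i d_i phi, d_j d_j phi>. *)
Lemma hessian_norm phi : test phi ->
  \sum_(i < N) \sum_(j < N) `|cl (pderivs [:: i; j] phi)| ^+ 2 = `|cl (Delta phi)| ^+ 2.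
Proof.
move=> tp; rewrite (L2_of_Delta tp); apply: L2_norm_sum => i j.
have tj := test_pderiv j tp.
have e1 := dot_pderiv i tj (test_pderivs [:: i; j] tp).
have e2 := dot_pderiv j tj (test_pderivs [:: i; i] tp).
rewrite -[pderiv j (pderivs [:: i; i] phi)](triple_pderivC i j (test_smooth tp)) in e2.
rewrite -[pderiv j (pderiv j phi)]/(pderivs [:: j; j] phi) in e2.
rewrite -[pderiv i (pderiv j phi)]/(pderivs [:: i; j] phi) in e1 e2.
have e4 := L2_dotC (cl (pderivs [:: j; j] phi)) (cl (pderivs [:: i; i] phi)).
exact: etrans e1 (etrans (esym e2) e4).
Qed.

Lemma test_sobolev k phi : test phi -> sobolev Omega k (cl phi).
Proof. by move=> tp s _; eexists; exact: is_wderivs_test. Qed.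

Lemma sobolev_norm0 k : sobolev_norm k (0 : E) = 0.
Proof.
rewrite /sobolev_norm big1 ?sqrtr0// => j _; rewrite big1// => s _.
by rewrite (wderivsE (is_wderivs0 s)) normr0 expr0n.
Qed.

Lemma test_sobolev0 k phi : test phi -> sobolev0 Omega k (cl phi).
Proof.
move=> tp; split=> [|e e0]; first exact: test_sobolev.
by exists (cl phi); [apply/test_classP; exists phi|rewrite subrr sobolev_norm0].
Qed.

Lemma sobolev_norm_ge k u s : (size s <= k)%N -> `|wderivs s u| <= sobolev_norm k u.
Proof.
move=> sk; rewrite /sobolev_norm -[leLHS]normr_id -sqrtr_sqr ler_sqrt; last first.
  by apply: sumr_ge0 => j _; apply: sumr_ge0 => t _; exact: sqr_ge0.
have sk' : (size s < k.+1)%N by [].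
rewrite (bigD1 (Ordinal sk')) //= (bigD1 (in_tuple s)) //=.
rewrite -addrA lerDl addr_ge0//; apply: sumr_ge0 => *; try exact: sqr_ge0.
by apply: sumr_ge0 => *; exact: sqr_ge0.
Qed.

Lemma wderivsB s u phi : (exists v, is_wderivs s u v) -> test phi ->
  wderivs s (u - (cl phi)) = wderivs s u - (cl (pderivs (rev s) phi)).
Proof.
move=> [v uv] tp; rewrite (wderivsE uv); apply: wderivsE.
have := is_wderivs_lin (-1) (is_wderivs_test s tp) uv.
by rewrite !scaleN1r !(addrC (- _)).
Qed.

Lemma wderivs_nil u : wderivs [::] u = u.
Proof. by apply: wderivsE; apply/is_wderivsP => phi tp; rewrite expr0 mul1r. Qed.

End weak_derivatives.

(** * The closure of the Laplacian on test functions *)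

Section laplacian_graph.
Context {R : realType} {N : nat}.
Variable Omega : domain R N.
Local Notation vol := (volume Omega).
Local Notation test := (test_function Omega).
Local Notation E := (L2 Omega).
Local Notation cl := (L2_of vol).
Implicit Types (u v w y z : E) (f g phi psi : 'rV[R]_N -> R) (s : seq 'I_N).

Lemma small_eq0 (x C : R) : (forall e, 0 < e -> `|x| <= e * C) -> x = 0.
Proof.
move=> h; apply/eqP; rewrite -normr_le0; apply/ler_addgt0Pr => e e0; rewrite add0r.
have C1 : 0 < `|C| + 1 by rewrite ltr_wpDl.
have := h (e / (`|C| + 1)); rewrite divr_gt0// => /(_ isT) /le_trans; apply.
rewrite mulrAC ler_pdivrMr// ler_pM2l// (le_trans (ler_norm _))//.
by rewrite lerDl.
Qed.

Lemma test_linP a phi psi : test phi -> test psi -> exists chi, [/\ test chi,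
  cl chi = a *: cl phi + cl psi,
  cl (Delta chi) = a *: cl (Delta phi) + cl (Delta psi) &
  forall s, cl (pderivs s chi) = a *: cl (pderivs s phi) + cl (pderivs s psi)].
Proof.
move=> tp ts; exists (a *: phi + psi); split.
- exact: test_lin.
- exact: L2_of_test_lin.
- by rewrite (Delta_lin a tp ts); exact: (L2_of_test_lin a (test_Delta tp) (test_Delta ts)).
- move=> s; rewrite (pderivsP s a (test_smooth tp) (test_smooth ts)).
  exact: (L2_of_test_lin a (test_pderivs s tp) (test_pderivs s ts)).
Qed.

Lemma test_subP phi psi : test phi -> test psi -> exists chi, [/\ test chi,
  cl (Delta chi) = cl (Delta psi) - cl (Delta phi) &
  forall s, cl (pderivs s chi) = cl (pderivs s psi) - cl (pderivs s phi)].
Proof.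
move=> tp ts; have [chi [tc _ h2 h3]] := test_linP (-1) tp ts.
have sw u v : -1 *: u + v = v - u by rewrite scaleN1r addrC.
exists chi; split; first exact: tc.
  exact: etrans h2 (sw (cl (Delta phi)) (cl (Delta psi))).
by move=> s; exact: etrans (h3 s) (sw (cl (pderivs s phi)) (cl (pderivs s psi))).
Qed.

Lemma grad_norm_test phi : test phi ->
  grad_norm (cl phi) = Num.sqrt (\sum_(i < N) `|cl (pderiv i phi)| ^+ 2).
Proof.
move=> tp; rewrite /grad_norm.
have h i : `|wderivs [:: i] (cl phi)| ^+ 2 = `|cl (pderiv i phi)| ^+ 2.
  by rewrite (wderivsE (is_wderivs_test [:: i] tp)).
by rewrite (eq_bigr _ (fun i _ => h i)).
Qed.

Lemma grad_sq phi : test phi ->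
  \sum_(i < N) `|cl (pderiv i phi)| ^+ 2 = - L2_dot (cl phi) (cl (Delta phi)).
Proof.
move=> tp; rewrite (dot_Delta tp tp) opprK.
have h i : `|cl (pderiv i phi)| ^+ 2 = L2_dot (cl (pderiv i phi)) (cl (pderiv i phi)).
  exact: esym (L2_dot_norm (cl (pderiv i phi))).
by rewrite (eq_bigr _ (fun i _ => h i)).
Qed.

Section bounds.
Variable c : R.
Hypotheses (c0 : 0 <= c) (hc : friedrichs_bound Omega c).

(** Read a = |phi|, g = |grad phi| and l = |Delta phi|. Then g^2 <= a l <= c g l, and dividing by g
    gives the first bound; inserting it in a <= c g produces c^2. *)
Lemma poincare_arith (a g l : R) : 0 <= g -> 0 <= l -> a <= c * g -> g ^+ 2 <= a * l ->
  g <= c * l /\ a <= c ^+ 2 * l.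
Proof.
move=> g0 l0 ag gl.
have gcl : g <= c * l.
  have [->|gn0] := eqVneq g 0; first by rewrite mulr_ge0.
  have gp : 0 < g by rewrite lt_def gn0.
  rewrite -(ler_pM2l gp) -expr2 (le_trans gl)//.
  by rewrite mulrA (mulrC g) ler_wpM2r.
by split=> //; rewrite (le_trans ag)// expr2 -mulrA ler_wpM2l.
Qed.

Lemma test_bounds phi : test phi ->
  let g := Num.sqrt (\sum_(i < N) `|cl (pderiv i phi)| ^+ 2) in
  g <= c * `|cl (Delta phi)| /\ `|cl phi| <= c ^+ 2 * `|cl (Delta phi)|.
Proof.
move=> tp g; apply: poincare_arith.
- exact: sqrtr_ge0.
- exact: normr_ge0.
- by have := hc (test_sobolev0 1 tp); rewrite (grad_norm_test tp).
- rewrite sqr_sqrtr; last by apply: sumr_ge0 => i _; exact: sqr_ge0.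
  rewrite (grad_sq tp).
  have := L2_cauchy_schwarz (cl phi) (cl (Delta phi)); rewrite ler_norml => /andP[h _].
  by rewrite lerNl.
Qed.

Lemma norm_le_sqrt_sum (F : 'I_N -> E) i :
  `|F i| <= Num.sqrt (\sum_(j < N) `|F j| ^+ 2).
Proof.
rewrite -[leLHS]normr_id -sqrtr_sqr ler_wsqrtr// (bigD1 i)//= lerDl.
by apply: sumr_ge0 => j _; exact: sqr_ge0.
Qed.

Lemma norm_le_sqrt_sum2 (F : 'I_N -> 'I_N -> E) i j (x : R) : 0 <= x ->
  \sum_(i < N) \sum_(j < N) `|F i j| ^+ 2 = x ^+ 2 -> `|F i j| <= x.
Proof.
move=> x0 h; rewrite -(@ler_pXn2r _ 2)// ?nnegrE//.
rewrite -h (bigD1 i)//= (bigD1 j)//= -addrA lerDl addr_ge0//.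
  by apply: sumr_ge0 => k _; exact: sqr_ge0.
by apply: sumr_ge0 => k _; apply: sumr_ge0 => l _; exact: sqr_ge0.
Qed.

(** The summands 1, c and c^2 are the constants for derivatives of order two, one and zero; their
    sum serves all three orders at once. *)
Lemma pderivs_bound s phi : test phi -> (size s <= 2)%N ->
  `|cl (pderivs s phi)| <= (1 + c + c ^+ 2) * `|cl (Delta phi)|.
Proof.
move=> tp; have [h1 h2] := test_bounds tp.
have h3 i j := norm_le_sqrt_sum2 i j (normr_ge0 _) (hessian_norm tp).
have h4 i := le_trans (norm_le_sqrt_sum (fun i => cl (pderiv i phi)) i) h1.
have l0 := normr_ge0 (cl (Delta phi)).
have cc : 0 <= c ^+ 2 by exact: sqr_ge0.
have le x : x <= 1 + c + c ^+ 2 -> x * `|cl (Delta phi)| <= (1 + c + c ^+ 2) * `|cl (Delta phi)|.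
  by move=> h; rewrite ler_wpM2r.
have d1 : 1 <= 1 + c + c ^+ 2 by rewrite -addrA lerDl addr_ge0.
have d2 : c <= 1 + c + c ^+ 2 by rewrite addrAC lerDr addr_ge0.
have d3 : c ^+ 2 <= 1 + c + c ^+ 2 by rewrite lerDr addr_ge0.
case: s => [|i [|j [|k s]]] // _.
- exact: le_trans h2 (le _ d3).
- exact: le_trans (h4 i) (le _ d2).
- by apply: le_trans (h3 i j) _; rewrite -[leLHS]mul1r; exact: le.
Qed.

Definition lap_graph u v : Prop := forall e, 0 < e ->
  exists2 phi, test phi & `|u - cl phi| <= e /\ `|v - cl (Delta phi)| <= e.

Lemma lap_graph_test phi : test phi -> lap_graph (cl phi) (cl (Delta phi)).
Proof. by move=> tp e e0; exists phi => //; rewrite !subrr normr0 ltW. Qed.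

Lemma lap_graph_lin a u v u' v' : lap_graph u v -> lap_graph u' v' ->
  lap_graph (a *: u + u') (a *: v + v').
Proof.
move=> h h' e e0.
have ap : 0 < `|a| + 1 by rewrite ltr_wpDl.
have [|phi tp [p1 p2]] := h (e / 2 / (`|a| + 1)); first by rewrite !divr_gt0.
have [|psi ts [q1 q2]] := h' (e / 2); first by rewrite divr_gt0.
have [chi [tc c1 c2 _]] := test_linP a tp ts.
have key x y x' y' : `|x - y| <= e / 2 / (`|a| + 1) -> `|x' - y'| <= e / 2 ->
    `|a *: x + x' - (a *: y + y')| <= e.
  move=> k1 k2; have -> : a *: x + x' - (a *: y + y') = a *: (x - y) + (x' - y') :> E.
    by rewrite scalerBr opprD addrACA.
  rewrite (le_trans (ler_normD _ _))// (splitr e) lerD// normrZ.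
  move: k1; rewrite ler_pdivlMr// mulrC; apply: le_trans.
  by rewrite ler_wpM2r// lerDl.
by exists chi => //; rewrite c1 c2; split; apply: key.
Qed.

Lemma lap_graph_closed u v :
  (forall e, 0 < e -> exists u' v', [/\ lap_graph u' v', `|u - u'| <= e & `|v - v'| <= e]) ->
  lap_graph u v.
Proof.
move=> h e e0; have e20 : 0 < e / 2 by rewrite divr_gt0.
have [u' [v' [g h1 h2]]] := h _ e20; have [phi tp [p1 p2]] := g _ e20.
exists phi => //; split; rewrite (splitr e).
  by rewrite -(subrKA u') (le_trans (ler_normD _ _))// lerD.
by rewrite -(subrKA v') (le_trans (ler_normD _ _))// lerD.
Qed.

Lemma lap_graph_bound u v : lap_graph u v -> `|u| <= c ^+ 2 * `|v|.
Proof.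
move=> g; apply/ler_addgt0Pr => e e0.
have c1 : 0 < 1 + c ^+ 2 by rewrite ltr_pwDl// sqr_ge0.
(* The error in u enters once and the error in v with the factor c^2, which together give e. *)
have [|phi tp [p1 p2]] := g (e / (1 + c ^+ 2)); first by rewrite divr_gt0.
have [_ b] := test_bounds tp.
set d := e / _ in p1 p2.
have h1 : `|u| <= `|cl phi| + d.
  by rewrite -[u](subrK (cl phi)) addrC (le_trans (ler_normD _ _))// lerD.
have h2 : `|cl (Delta phi)| <= `|v| + d.
  rewrite -[cl (Delta phi)](subrK v) addrC (le_trans (ler_normD _ _))// lerD//.
  by rewrite distrC.
apply: (le_trans h1).
apply: (@le_trans _ _ (c ^+ 2 * (`|v| + d) + d)).
  by rewrite lerD2r (le_trans b)// ler_wpM2l// sqr_ge0.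
rewrite mulrDr -addrA lerD2l.
by rewrite -[X in _ + X]mul1r -mulrDl addrC /d mulrC divfK// gt_eqF.
Qed.

(** When u is a test function this is the definition of the weak Laplacian of y, and both sides are
    continuous in the pair (u, v). Only one of the two arguments has to be approximable by test
    functions, which makes the identity fit for computing the adjoint. *)
Lemma lap_graph_dot u v y z : lap_graph u v -> is_laplacian y z -> L2_dot v y = L2_dot u z.
Proof.
move=> g /is_laplacianP yz; apply/eqP; rewrite -subr_eq0; apply/eqP.
apply: (@small_eq0 _ (`|y| + `|z|)) => e e0.
have [phi tp [p1 p2]] := g _ e0.
have h : L2_dot (cl (Delta phi)) y = L2_dot (cl phi) z.
  by rewrite L2_dotC yz// L2_dotC.
have -> : L2_dot v y - L2_dot u z =
    L2_dot (v - cl (Delta phi)) y - L2_dot (u - cl phi) z.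
  by rewrite !L2_dotBl h; ring.
rewrite (le_trans (ler_normB _ _))// mulrDr lerD//.
  by rewrite (le_trans (L2_cauchy_schwarz _ _))// ler_wpM2r.
by rewrite (le_trans (L2_cauchy_schwarz _ _))// ler_wpM2r.
Qed.

Lemma lap_graph_laplacian u v : lap_graph u v -> is_laplacian u v.
Proof.
move=> g; apply/is_laplacianP => phi tp.
exact: esym (lap_graph_dot g (is_laplacian_test tp)).
Qed.

(** Differences of approximants are test functions, so by [pderivs_bound] their derivatives form a
    Cauchy sequence as soon as their Laplacians do. One [phi] approximates all three elements, so
    identities between them survive the limit. *)
Lemma lap_graph_wderivs u v s : lap_graph u v -> (size s <= 2)%N ->
  exists w, forall e, 0 < e -> exists2 phi, test phi &
    [/\ `|u - cl phi| <= e, `|v - cl (Delta phi)| <= e & `|w - cl (pderivs s phi)| <= e].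
Proof.
move=> g s2; pose K := 1 + c + c ^+ 2.
have K0 : 0 < K by rewrite /K -addrA ltr_pwDl// addr_ge0// sqr_ge0.
have h0 n : 0 < (n.+1%:R^-1 : R) by rewrite invr_gt0.
have /choice[phi phiP] n : exists phi, test phi /\
    `|u - cl phi| <= n.+1%:R^-1 /\ `|v - cl (Delta phi)| <= n.+1%:R^-1.
  by have [phi tp h] := g _ (h0 n); exists phi.
have small := @eventually_invn_le R.
have [|w wP] := @L2_complete _ _ _ vol (fun n => cl (pderivs s (phi n))).
  move=> e e0; have [|n0 n0P] := small (e / (2 * K)); first by rewrite divr_gt0// mulr_gt0.
  exists n0 => m n mn nn.
  have [tm [_ dm]] := phiP m; have [tn [_ dn]] := phiP n.
  have [chi [tc c1 c2]] := test_subP tn tm.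
  rewrite -c2 (le_trans (pderivs_bound tc s2))// -/K mulrC -ler_pdivlMr// c1.
  rewrite (_ : e / K = e / (2 * K) + e / (2 * K)); last by field; rewrite gt_eqF.
  rewrite -(subrKA v) (le_trans (ler_normD _ _))// lerD//.
    by rewrite distrC (le_trans dm)// n0P.
  by rewrite (le_trans dn)// n0P.
exists w => e e0; have [n0 n0P] := small _ e0; have [n1 n1P] := wP _ e0.
pose n := maxn n0 n1; have [tn [d1 d2]] := phiP n.
exists (phi n) => //; split.
- by rewrite (le_trans d1)// n0P// leq_maxl.
- by rewrite (le_trans d2)// n0P// leq_maxl.
- by rewrite distrC n1P// leq_maxr.
Qed.

Lemma lap_graph_is_wderivs u v s : lap_graph u v -> (size s <= 2)%N ->
  exists2 w, is_wderivs s u w & forall e, 0 < e -> exists2 phi, test phi &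
    `|v - cl (Delta phi)| <= e /\ `|w - cl (pderivs (rev s) phi)| <= e.
Proof.
move=> g s2; have [|w wP] := @lap_graph_wderivs u v (rev s) g; first by rewrite size_rev.
exists w; last by move=> e e0; have [phi tp [_ h1 h2]] := wP e e0; exists phi.
apply/is_wderivsP => psi ts; set k := (-1) ^+ _.
apply/eqP; rewrite -subr_eq0; apply/eqP.
apply: (@small_eq0 _ (`|cl (pderivs s psi)| + `|cl psi|)) => e e0.
have [phi tp [p1 _ p2]] := wP _ e0.
have := is_wderivs_test s tp => /is_wderivsP /(_ _ ts); rewrite -/k => h.
have -> : L2_dot u (cl (pderivs s psi)) - k * L2_dot w (cl psi) =
    L2_dot (u - cl phi) (cl (pderivs s psi)) - k * L2_dot (w - cl (pderivs (rev s) phi)) (cl psi).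
  by rewrite !L2_dotBl h; ring.
have k1 : `|k| = 1 by rewrite normrX normrN1 expr1n.
rewrite (le_trans (ler_normB _ _))// mulrDr normrM k1 mul1r lerD//.
  by rewrite (le_trans (L2_cauchy_schwarz _ _))// ler_wpM2r.
by rewrite (le_trans (L2_cauchy_schwarz _ _))// ler_wpM2r.
Qed.

(** The approximants found for one [s] need not suit another, while [sobolev0] asks for a single
    test function. Here closeness of the Laplacians alone forces closeness of each derivative, for
    any given [phi]. *)
Lemma lap_graph_wderivs_near u v s phi e : lap_graph u v -> (size s <= 2)%N ->
  test phi -> `|v - cl (Delta phi)| <= e ->
  `|wderivs s u - cl (pderivs (rev s) phi)| <= (1 + c + c ^+ 2) * e.
Proof.
move=> g s2 tp pe; have [w uw wP] := lap_graph_is_wderivs g s2.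
rewrite (wderivsE uw); pose K := 1 + c + c ^+ 2; rewrite -/K.
have K0 : 0 < K by rewrite /K -addrA ltr_pwDl// addr_ge0// sqr_ge0.
apply/ler_addgt0Pr => d d0.
(* With d' = d / (1 + K) the total error d' + K (d' + e) is exactly K e + d. *)
have [|psi ts [q1 q2]] := wP (d / (1 + K)); first by rewrite divr_gt0// addr_gt0.
have [chi [tc c1 c2]] := test_subP tp ts.
have s2' : (size (rev s) <= 2)%N by rewrite size_rev.
have b := pderivs_bound tc s2'; rewrite c1 c2 -/K in b.
set d' := d / _ in q1 q2.
have -> : K * e + d = d' + K * (d' + e).
  by rewrite mulrDr addrA -[X in X + _ + _]mul1r -mulrDl /d' [(1 + K) * _]mulrC divfK 1?addrC// gt_eqF// addr_gt0.
rewrite -(subrKA (cl (pderivs (rev s) psi))) (le_trans (ler_normD _ _))// lerD//.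
rewrite (le_trans b)// ler_wpM2l ?(ltW K0)//.
by rewrite -(subrKA v) (le_trans (ler_normD _ _))// lerD// distrC.
Qed.

Lemma lap_graph_sobolev0 u v : lap_graph u v -> sobolev0 Omega 2 u.
Proof.
move=> g; have su : sobolev Omega 2 u.
  by move=> s s2; have [w uw _] := lap_graph_is_wderivs g s2; exists w.
split=> // e e0.
(* [C] counts the derivatives in [sobolev_norm 2]. An error of at most e / (C + 1) in each gives a
   sum of squares of at most C (e / (C + 1))^2, which is below e^2. *)
pose C : R := \sum_(j < 3) \sum_(s : j.-tuple 'I_N) 1.
have C0 : 0 <= C by apply: sumr_ge0 => j _; apply: sumr_ge0 => s _.
pose K := 1 + c + c ^+ 2.
have K0 : 0 < K by rewrite /K -addrA ltr_pwDl// addr_ge0// sqr_ge0.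
pose d := e / (C + 1) / K.
have C1 : 0 < C + 1 by rewrite ltr_wpDl.
have d0 : 0 < d by rewrite !divr_gt0.
have [phi tp [_ pd]] := g _ d0.
exists (cl phi); first by apply/test_classP; exists phi.
have Kd : K * d = e / (C + 1) by rewrite /d mulrC divfK// gt_eqF.
have le1 : \sum_(j < 3) \sum_(s : j.-tuple 'I_N) `|wderivs s (u - cl phi)| ^+ 2
    <= C * (e / (C + 1)) ^+ 2.
  rewrite /C mulr_suml; apply: ler_sum => j _; rewrite mulr_suml; apply: ler_sum => s _.
  have s2 : (size s <= 2)%N by rewrite size_tuple -ltnS.
  rewrite mul1r -Kd (wderivsB (su _ s2) tp) lerXn2r ?nnegrE//; first by rewrite mulr_ge0 ?ltW.
  exact: (lap_graph_wderivs_near g s2 tp pd).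
rewrite -[ltRHS]ger0_norm ?(ltW e0)// -sqrtr_sqr ltr_sqrt ?exprn_gt0//.
apply: le_lt_trans le1 _.
rewrite expr_div_n mulrCA gtr_pMr ?exprn_gt0// ltr_pdivrMr ?exprn_gt0// mul1r.
rewrite sqrrD expr1n mulr1 mulr2n; have := sqr_ge0 C; lra.
Qed.

End bounds.

(** The Laplacian is the trace of the weak Hessian. Its N terms are each approximated within e / (N
    + 1), where the 1 keeps the denominator positive. *)
Lemma sobolev0_lap_graph u : sobolev0 Omega 2 u -> exists v, lap_graph u v.
Proof.
move=> [su ap]; exists (\sum_(i < N) wderivs [:: i; i] u) => e e0.
have N1 : 0 < N%:R + 1 :> R by rewrite ltr_wpDl.
have [|_ /test_classP[phi tp ->] h] := ap (e / (N%:R + 1)); first by rewrite divr_gt0.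
have hs s : (size s <= 2)%N -> `|wderivs s u - cl (pderivs (rev s) phi)| <= e / (N%:R + 1).
  move=> s2; rewrite -(wderivsB (su _ s2) tp).
  exact: le_trans (sobolev_norm_ge _ s2) (ltW h).
have eN : e / (N%:R + 1) <= e by rewrite ler_pdivrMr// mulrDr mulr1 lerDr mulr_ge0// ltW.
exists phi => //; split.
  by have := hs [::] isT; rewrite wderivs_nil => /le_trans; apply.
rewrite (L2_of_Delta tp) -sumrB (le_trans (ler_norm_sum _ _ _))//.
apply: (@le_trans _ _ (\sum_(i < N) (e / (N%:R + 1)))).
  by apply: ler_sum => i _; exact: (hs [:: i; i] isT).
rewrite sumr_const card_ord -(mulr_natr (e / _)) mulrAC ler_pdivrMr// ler_pM2l//.
by rewrite lerDl.
Qed.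

End laplacian_graph.

(** * The Laplace operators *)

Section operator_theory.
Context {R : realType} {V : normedModType R}.
Implicit Types (T : operator V) (x y : V).

Lemma op_linear0 T : op_linear T -> T 0 = 0.
Proof.
move=> [d0 /(_ (-1) 0 0 d0 d0) [_]].
by rewrite scaler0 addr0 scaleN1r addrC subrr.
Qed.

Lemma op_linearZ T a x : op_linear T -> op_dom T x ->
  op_dom T (a *: x) /\ T (a *: x) = a *: T x.
Proof.
move=> lT dx; have [d0 /(_ a x 0 dx d0)] := lT.
by rewrite !addr0 (op_linear0 lT) addr0.
Qed.

Lemma op_linearB T x y : op_linear T -> op_dom T x -> op_dom T y ->
  op_dom T (x - y) /\ T (x - y) = T x - T y.
Proof.
move=> lT dx dy; have [_ /(_ (-1) y x dy dx)] := lT.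
by rewrite !scaleN1r ![- _ + _]addrC.
Qed.

Lemma op_injP T : op_linear T -> (forall x, op_dom T x -> T x = 0 -> x = 0) ->
  set_inj (op_dom T) T.
Proof.
move=> lT kT x y; rewrite !inE => dx dy e; have [d h] := op_linearB lT dx dy.
by apply/eqP; rewrite -subr_eq0; apply/eqP; apply: kT => //; rewrite h e subrr.
Qed.

Lemma op_injE T x y : set_inj (op_dom T) T -> op_dom T x -> op_dom T y ->
  T x = T y -> x = y.
Proof. by move=> iT dx dy; apply: iT; rewrite inE. Qed.

Lemma op_invK T x : set_inj (op_dom T) T -> op_dom T x -> op_inv T (T x) = x.
Proof.
move=> iT dx; rewrite /op_inv /=; case: xgetP => [y _ [dy e]|/(_ x)]; last by case.
by apply: iT => //; rewrite inE.
Qed.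

Lemma op_inv_linear T : op_linear T -> set_inj (op_dom T) T -> op_linear (op_inv T).
Proof.
move=> lT iT; split; first by exists 0; [have [] := lT|exact: op_linear0].
move=> a _ _ [x dx <-] [y dy <-]; have [_ /(_ a x y dx dy) [dxy e]] := lT.
split; first by exists (a *: x + y).
by rewrite -[LHS](congr1 (op_inv T) e) !op_invK.
Qed.

Lemma op_norm_ubound T C : 0 <= C -> (forall x, op_dom T x -> `|T x| <= C * `|x|) ->
  ubound [set `|T x| | x in op_dom T `&` [set x | `|x| <= 1]] C.
Proof.
move=> C0 h _ [x [dx /= x1] <-]; apply: le_trans (h x dx) _.
by rewrite -[leRHS]mulr1 ler_wpM2l.
Qed.

Lemma op_norm_le T C : op_linear T -> 0 <= C ->
  (forall x, op_dom T x -> `|T x| <= C * `|x|) -> op_norm T <= C.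
Proof.
move=> lT C0 h; apply: ge_sup; last exact: op_norm_ubound.
by exists `|T 0|, 0 => //; split; [have [] := lT|rewrite /= normr0].
Qed.

Lemma op_norm_ge T x : op_linear T -> op_bounded T -> op_dom T x ->
  `|T x| <= op_norm T * `|x|.
Proof.
move=> lT [C h] dx.
have [->|x0] := eqVneq x 0; first by rewrite (op_linear0 lT) !normr0 mulr0.
have xp : 0 < `|x| by rewrite normr_gt0.
have [dz ez] := op_linearZ (`|x|^-1) lT dx.
rewrite -ler_pdivrMr// mulrC.
have -> : `|x|^-1 * `|T x| = `|T (`|x|^-1 *: x)|.
  by rewrite ez normrZ ger0_norm// invr_ge0.
apply: ub_le_sup.
  exists `|C|; apply: op_norm_ubound => // y dy.
  by rewrite (le_trans (h y dy))// ler_wpM2r// ler_norm.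
exists (`|x|^-1 *: x) => //; split=> //=.
by rewrite normrZ ger0_norm ?invr_ge0// mulVf// gt_eqF.
Qed.

Lemma op_norm_ge0 T : op_linear T -> op_bounded T -> 0 <= op_norm T.
Proof.
move=> lT [C h]; have d0 := lT.1.
apply: (@le_trans _ _ `|T 0|); first exact: normr_ge0.
apply: ub_le_sup.
  exists `|C|; apply: op_norm_ubound => // y dy.
  by rewrite (le_trans (h y dy))// ler_wpM2r// ler_norm.
by exists 0 => //; split=> //=; rewrite normr0.
Qed.

Lemma closed_pairs (A : set (V * V)) :
  (forall x y, (forall e, 0 < e -> exists x' y', [/\ A (x', y'), `|x - x'| <= e & `|y - y'| <= e]) ->
    A (x, y)) -> closed A.
Proof.
move=> h [x y] cA; apply: h => e e0.
have [[x' y'] [Axy [/= h1 h2]]] := cA (ball (x, y) e) (nbhsx_ballx (x, y) e e0).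
exists x', y'; split=> //; apply: ltW.
  by move: h1; rewrite -ball_normE.
by move: h2; rewrite -ball_normE.
Qed.

End operator_theory.

Section laplace_operators.
Context {R : realType} {N : nat}.
Variable Omega : domain R N.
Local Notation vol := (volume Omega).
Local Notation test := (test_function Omega).
Local Notation E := (L2 Omega).
Local Notation cl := (L2_of vol).
Local Notation G := (@lap_graph R N Omega).
Local Notation H := (L2_harmonic Omega).
Local Notation L0 := (laplace_min Omega).
Local Notation L := (laplace_max Omega).
Local Notation Lr := (laplace_red Omega).
Local Notation Hp := (L2_ortho H).
Implicit Types (u v w f y z : E).

Lemma friedrichs_constant_ge0 : friedrichs_admissible Omega -> 0 <= friedrichs_constant Omega.
Proof.
move=> [c c0 hc]; apply: lb_le_inf; first by exists c.
by move=> x [/ltW].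
Qed.

(** For a fixed u with nonzero gradient, |u| / |grad u| is a lower bound of all admissible constants
    and hence of their infimum. If the gradient is zero, any admissible constant gives u = 0. *)
Lemma friedrichs_constant_bound : friedrichs_admissible Omega ->
  friedrichs_bound Omega (friedrichs_constant Omega).
Proof.
move=> [c c0 hc] u su; have g0 : 0 <= grad_norm u by exact: sqrtr_ge0.
have [g1|g1] := eqVneq (grad_norm u) 0.
  by have := hc u su; rewrite g1 !mulr0.
have gp : 0 < grad_norm u by rewrite lt_def g1.
rewrite -ler_pdivrMr//; apply: lb_le_inf; first by exists c.
by move=> x [x0 hx]; rewrite ler_pdivrMr//; exact: hx.
Qed.

Lemma lap_graph_laplacianE u v : G u v -> laplacian u = v.
Proof. by move=> /lap_graph_laplacian/laplacianE. Qed.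

Lemma sobolev0_graph u : sobolev0 Omega 2 u -> G u (laplacian u).
Proof.
by move=> /sobolev0_lap_graph[v g]; rewrite (lap_graph_laplacianE g).
Qed.

Lemma lap_graph_zero u v : G u v -> G 0 0.
Proof. by move=> g; have := lap_graph_lin (-1) g g; rewrite !scaleN1r ![- _ + _]addrC !subrr. Qed.

Lemma lap_graph0 : G 0 0.
Proof. exact: lap_graph_zero (lap_graph_test (test0 Omega)). Qed.

Lemma laplace_max_linear : op_linear L.
Proof.
split; first by exists 0; exact: is_laplacian0.
move=> a u v du dv; have h := is_laplacian_lin a (laplacianP du) (laplacianP dv).
split; first by exists (a *: laplacian u + laplacian v).
by rewrite /= (laplacianE h) opprD scalerN.
Qed.

Lemma ortho_subspace (A : set E) : L2_subspace (L2_ortho A).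
Proof.
split=> [v _|a u v hu hv w Aw]; first exact: L2_dot0l.
by rewrite L2_dotPl hu// hv// mulr0 addr0.
Qed.

Lemma laplace_red_linear : op_linear Lr.
Proof.
have [L1 L2] := laplace_max_linear; have [P1 P2] := ortho_subspace H.
split; first by split.
move=> a u v [du pu] [dv pv]; have [h1 h2] := L2 a u v du dv.
by split=> //; split=> //; exact: P2.
Qed.

Lemma test_class_subspace : L2_subspace (test_class Omega).
Proof.
split; first by apply/test_classP; exists (cst 0); [exact: test0|exact: esym (L2_of_test0 Omega)].
move=> a _ _ /test_classP[phi tp ->] /test_classP[psi ts ->].
have [chi [tc h _ _]] := test_linP a tp ts.
by apply/test_classP; exists chi => //; exact: esym h.
Qed.

Lemma laplace_min_dense : op_densely_defined L0.
Proof.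
move=> O [u Ou] oO; have : nbhs u O by apply: open_nbhs_nbhs.
move=> /nbhs_ballP[e /= e0 eO].
have [||v /test_classP[phi tp ->] uv] := @L2_dense_of_ortho _ _ _ vol (test_class Omega)
    test_class_subspace _ u (e / 2).
- move=> w h; apply: L2_eq_test => phi tp; rewrite L2_dot0l; apply: h.
  by apply/test_classP; exists phi.
- by rewrite divr_gt0.
exists (cl phi); split; last exact: test_sobolev0.
apply: eO; rewrite -ball_normE /ball_ /=; apply: le_lt_trans uv _.
by rewrite ltr_pdivrMr// ltr_pMr// ltr1n.
Qed.

(** Restricted to test functions, the adjoint relation is the distributional equation;
    [lap_graph_dot] extends it from there to all of [sobolev0 2]. *)
Lemma adjoint_laplacian y z : adjoint_rel L0 y z <-> is_laplacian y (- z).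
Proof.
split=> [h|h u du]; last first.
  rewrite /= L2_dotNl (lap_graph_dot (sobolev0_graph du) h) L2_dotNr opprK//.
apply/is_laplacianP => phi tp.
have := h (cl phi) (test_sobolev0 2 tp).
rewrite /= (lap_graph_laplacianE (lap_graph_test tp)) L2_dotNl => e.
by rewrite L2_dotC -[LHS]opprK e L2_dotNl L2_dotC.
Qed.

(** Equality of graphs compares the domains and the values on them. The vector chosen by [xget] in
    the adjoint is determined because the weak Laplacian of y is. *)
Lemma adjoint_graph : op_graph (op_adjoint L0) = op_graph L.
Proof.
have adjE y z : adjoint_rel L0 y z -> op_adjoint L0 y = z.
  move=> h; rewrite /op_adjoint /=; case: xgetP => [w _ hw|/(_ z)//].
  apply: oppr_inj; rewrite -(laplacianE (proj1 (adjoint_laplacian _ _) hw)).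
  exact: laplacianE (proj1 (adjoint_laplacian _ _) h).
have LE y z : is_laplacian y (- z) -> L y = z.
  by move=> h; rewrite /= (laplacianE h) opprK.
apply/seteqP; split=> _ [y dy <-].
  have [z hz] := dy; have hz' := proj1 (adjoint_laplacian y z) hz.
  exists y; first by exists (- z).
  by rewrite (adjE _ _ hz) (LE _ _ hz').
have hy : is_laplacian y (- (- laplacian y)) by rewrite opprK; exact: laplacianP.
have hz := proj2 (adjoint_laplacian y (- laplacian y)) hy.
exists y; first by exists (- laplacian y).
by rewrite (adjE _ _ hz).
Qed.

(** * Ranges, kernels and inverses on a Friedrichs admissible domain *)

Section admissible.
Hypothesis hOmega : friedrichs_admissible Omega.
Local Notation c := (friedrichs_constant Omega).
Let c0 := friedrichs_constant_ge0 hOmega.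
Let hc := friedrichs_constant_bound hOmega.
Let cc0 : 0 <= c ^+ 2. Proof. exact: sqr_ge0. Qed.

Lemma graph_sobolev0 u v : G u v -> sobolev0 Omega 2 u.
Proof. exact: (lap_graph_sobolev0 c0 hc). Qed.

Lemma laplace_min_linear : op_linear L0.
Proof.
split; first exact: graph_sobolev0 lap_graph0.
move=> a u v du dv; have h := lap_graph_lin a (sobolev0_graph du) (sobolev0_graph dv).
split; first exact: graph_sobolev0 h.
by rewrite /= (lap_graph_laplacianE h) opprD scalerN.
Qed.

Lemma laplace_min_graph u f : op_graph L0 (u, f) <-> G u (- f).
Proof.
split=> [[w dw [<- <-]]|g]; first by rewrite opprK; exact: sobolev0_graph.
exists u; first exact: graph_sobolev0 g.
by rewrite /= (lap_graph_laplacianE g) opprK.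
Qed.

Lemma laplace_min_closed : op_closed L0.
Proof.
apply: closed_pairs => u f h; apply/laplace_min_graph; apply: lap_graph_closed => e e0.
have [u' [f' [/laplace_min_graph g h1 h2]]] := h e e0.
by exists u', (- f'); split=> //; rewrite -opprD normrN.
Qed.

Lemma range_minP f : op_range L0 f <-> exists u, G u (- f).
Proof.
split=> [[u du <-]|[u /laplace_min_graph[w dw [_ e]]]]; last by exists w.
by exists u; rewrite opprK; exact: sobolev0_graph.
Qed.

Lemma laplace_min_bound u : sobolev0 Omega 2 u -> `|u| <= c ^+ 2 * `|L0 u|.
Proof. by move=> /sobolev0_graph g; rewrite normrN; exact: (lap_graph_bound c0 hc g). Qed.

Lemma laplace_min_inj : set_inj (op_dom L0) L0.
Proof.
apply: (op_injP laplace_min_linear) => u du e.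
have := laplace_min_bound du; rewrite e normr0 mulr0 normr_le0 => /eqP; exact.
Qed.

Lemma laplace_min_boundB u v : sobolev0 Omega 2 u -> sobolev0 Omega 2 v ->
  `|u - v| <= c ^+ 2 * `|L0 u - L0 v|.
Proof.
move=> du dv; have [d e] := op_linearB laplace_min_linear du dv.
exact: (eq_ind _ (fun z => `|u - v| <= c ^+ 2 * `|z|) (laplace_min_bound d) _ e).
Qed.

Lemma range_min_subspace : L2_subspace (op_range L0).
Proof.
split; first by apply/range_minP; exists 0; rewrite oppr0; exact: lap_graph0.
move=> a f g /range_minP[u gu] /range_minP[v gv]; apply/range_minP.
by exists (a *: u + v); rewrite opprD -scalerN; exact: lap_graph_lin.
Qed.

(** When L0 u_n converges, the bound by c^2 makes u_n a Cauchy sequence, and the limit pair stays in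
    the closed graph. *)
Lemma range_min_closed : L2_closed (op_range L0).
Proof.
move=> f h.
have /choice[u uP] n : exists u, sobolev0 Omega 2 u /\ `|f - L0 u| <= n.+1%:R^-1.
  by have [|_ [u du <-] hu] := h n.+1%:R^-1; [rewrite invr_gt0|exists u].
have c1 : 0 < c ^+ 2 + 1 by rewrite ltr_wpDl.
have small := @eventually_invn_le R.
have [|w wP] := @L2_complete _ _ _ vol u.
  move=> e e0; have [|n0 n0P] := small (e / 2 / (c ^+ 2 + 1)); first by rewrite !divr_gt0.
  exists n0 => m n nm nn; have [dm hm] := uP m; have [dn hn] := uP n.
  apply: (le_trans (laplace_min_boundB dm dn)).
  have : `|L0 (u m) - L0 (u n)| <= e / (c ^+ 2 + 1).
    rewrite -(subrKA f) (le_trans (ler_normD _ _))//.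
    rewrite (_ : e / (c ^+ 2 + 1) = e / 2 / (c ^+ 2 + 1) + e / 2 / (c ^+ 2 + 1)); last first.
      by rewrite -mulrDl -splitr.
    by rewrite lerD//; [rewrite distrC (le_trans hm)// n0P|rewrite (le_trans hn)// n0P].
  rewrite ler_pdivlMr// => b'; apply: le_trans b'.
  by rewrite mulrC ler_wpM2l// lerDl.
apply/range_minP; exists w; apply: lap_graph_closed => e e0.
have [n0 n0P] := small _ e0; have [n1 n1P] := wP _ e0; pose n := maxn n0 n1.
have [dn hn] := uP n.
exists (u n), (laplacian (u n)); split; first exact: sobolev0_graph.
  by rewrite distrC n1P// leq_maxr.
rewrite -opprD normrN -[laplacian _]opprK.
exact: le_trans hn (n0P _ (leq_maxl _ _)).
Qed.

(** The part of f orthogonal to the range satisfies the adjoint relation with 0, so it is harmonic.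
    If f is orthogonal to the harmonic functions, this part is orthogonal both to f and to the
    projection, hence to itself. *)
Lemma range_min : op_range L0 = Hp.
Proof.
apply/seteqP; split=> [f /range_minP[u g] h hh|f hf].
  by rewrite -[f]opprK L2_dotNl (lap_graph_dot g hh) L2_dot0r oppr0.
have [w wM fw] := L2_projection f range_min_subspace range_min_closed.
have hh : H (f - w).
  have : adjoint_rel L0 (f - w) 0.
    by move=> u du; rewrite L2_dot0r fw//; exists u.
  by move=> /adjoint_laplacian; rewrite oppr0.
suff -> : f = w by [].
apply/eqP; rewrite -subr_eq0 -normr_eq0 -sqrf_eq0 -L2_dot_norm L2_dotBl.
by rewrite (hf _ hh) (fw _ wM) subrr.
Qed.

Lemma ker_max : op_ker L = H.
Proof.
apply/seteqP; split=> [u [du /= e]|u hu].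
  by have := laplacianP du; rewrite -[laplacian u]opprK e oppr0.
by split; [exists 0|rewrite /= (laplacianE hu) oppr0].
Qed.

(** The functional is bounded by [laplace_min_bound], and <L0 u, w> = <u, f> is the adjoint relation
    for its representative. Representing it on the range of L0 also makes w orthogonal to the
    harmonic functions, by [range_min]. *)
Lemma red_surj f : exists w, [/\ H_Delta Omega w, Hp w & L w = f].
Proof.
have [||w wM wP] := @L2_riesz _ _ _ vol (op_range L0)
    (fun g => L2_dot (op_inv L0 g) f) (c ^+ 2 * `|f|) range_min_subspace range_min_closed.
- move=> a g h gM hM; have [_ /(_ a g h gM hM) [_ ->]] := op_inv_linear laplace_min_linear laplace_min_inj.
  exact: L2_dotPl.
- move=> _ [u du <-]; rewrite (op_invK laplace_min_inj du).
  rewrite (le_trans (L2_cauchy_schwarz _ _))// mulrAC ler_wpM2r//.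
  exact: laplace_min_bound.
have hw : is_laplacian w (- f).
  apply/adjoint_laplacian => u du; rewrite wP; last by exists u.
  by rewrite (op_invK laplace_min_inj du).
exists w; split; first by exists (- f).
  by rewrite -range_min.
by rewrite /= (laplacianE hw) opprK.
Qed.

Lemma red_inj : set_inj (op_dom Lr) Lr.
Proof.
apply: (op_injP laplace_red_linear) => u [du pu] e.
have hh : H u by rewrite -ker_max; split; [exact: du|exact: e].
by have := pu _ hh; rewrite L2_dot_norm => /eqP; rewrite sqrf_eq0 normr_eq0 => /eqP.
Qed.

(** As w = L0 u for some u, |w|^2 = <u, L w> <= |u| |L w| <= C |w| |L w|. The constant is left free:
    c^2 yields the a priori estimate, and the norm of the inverse of L0 yields one half of the
    equality of norms. *)
Lemma red_bound w : H_Delta Omega w -> Hp w -> forall C, 0 <= C ->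
  (forall f, op_range L0 f -> `|op_inv L0 f| <= C * `|f|) -> `|w| <= C * `|L w|.
Proof.
move=> dw pw C C0 h; move: (pw); rewrite -range_min => -[u du e].
have hu := h w; rewrite -e (op_invK laplace_min_inj du) in hu.
have {}hu : `|u| <= C * `|w| by rewrite -e; apply: hu; exists u.
have hw : adjoint_rel L0 w (L w).
  by apply/adjoint_laplacian; rewrite /= opprK; exact: laplacianP.
have := hw u du; rewrite e L2_dot_norm => ww.
have [->|w0] := eqVneq w 0; first by rewrite normr0 mulr_ge0.
have wp : 0 < `|w| by rewrite normr_gt0.
rewrite -(ler_pM2l wp) -expr2 ww (le_trans (ler_norm _))//.
rewrite (le_trans (L2_cauchy_schwarz _ _))// mulrA [_ * C]mulrC.
by rewrite ler_wpM2r.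
Qed.

Lemma inv_min_bounded : forall f, op_range L0 f -> `|op_inv L0 f| <= c ^+ 2 * `|f|.
Proof.
by move=> _ [u du <-]; rewrite (op_invK laplace_min_inj du); exact: laplace_min_bound.
Qed.

Lemma inv_red_bounded C : 0 <= C ->
  (forall f, op_range L0 f -> `|op_inv L0 f| <= C * `|f|) ->
  forall f, op_range Lr f -> `|op_inv Lr f| <= C * `|f|.
Proof.
move=> C0 h _ [u [du pu] <-]; rewrite (op_invK red_inj (conj du pu : op_dom Lr u)).
exact: red_bound.
Qed.

(** The mirror image: choosing w with L w = u gives |u|^2 = <L0 u, w> <= C |L0 u| |u|. *)
Lemma inv_min_red_bounded C : 0 <= C ->
  (forall f, op_range Lr f -> `|op_inv Lr f| <= C * `|f|) ->
  forall f, op_range L0 f -> `|op_inv L0 f| <= C * `|f|.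
Proof.
move=> C0 h _ [u du <-]; rewrite (op_invK laplace_min_inj du).
have [w [dw pw e]] := red_surj u.
have hw : adjoint_rel L0 w u.
  by apply/adjoint_laplacian; rewrite -e /= opprK; exact: laplacianP.
have hwb : `|w| <= C * `|u|.
  have k := op_invK red_inj (conj dw pw : op_dom Lr w).
  have := h u; rewrite -[X in op_inv Lr X]e [op_inv Lr _]k; apply.
  by exists w.
have := hw u du; rewrite L2_dot_norm => uu.
have [->|u0] := eqVneq u 0; first by rewrite normr0 mulr_ge0.
have up : 0 < `|u| by rewrite normr_gt0.
rewrite -(ler_pM2l up) -expr2 -uu (le_trans (ler_norm _))//.
rewrite (le_trans (L2_cauchy_schwarz _ _))// mulrC mulrA [_ * C]mulrC.
by rewrite ler_wpM2r.
Qed.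

Lemma inv_norms : [/\ op_bounded (op_inv L0), op_bounded (op_inv Lr),
  op_norm (op_inv L0) = op_norm (op_inv Lr) & op_norm (op_inv Lr) <= c ^+ 2].
Proof.
have l1 := op_inv_linear laplace_min_linear laplace_min_inj.
have l2 := op_inv_linear laplace_red_linear red_inj.
have b1 : op_bounded (op_inv L0) by exists (c ^+ 2); exact: inv_min_bounded.
have b2 : op_bounded (op_inv Lr).
  by exists (c ^+ 2); exact: inv_red_bounded cc0 inv_min_bounded.
split=> //; last exact: op_norm_le l2 cc0 (inv_red_bounded cc0 inv_min_bounded).
(* The norm of each inverse is an admissible constant for the other. *)
apply/eqP; rewrite eq_le; apply/andP; split.
  apply: (op_norm_le l1 (op_norm_ge0 l2 b2)).
  by apply: (inv_min_red_bounded (op_norm_ge0 l2 b2)) => f hf; exact: op_norm_ge.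
apply: (op_norm_le l2 (op_norm_ge0 l1 b1)).
by apply: (inv_red_bounded (op_norm_ge0 l1 b1)) => f hf; exact: op_norm_ge.
Qed.

End admissible.
End laplace_operators.

Theorem mainTheorem4 (R : realType) (N : nat) (Omega : domain R N)
    (hOmega : friedrichs_admissible Omega) :
  let c_f := friedrichs_constant Omega in
  let Hperp := L2_ortho (L2_harmonic Omega) in
  let L0 := laplace_min Omega in
  let L := laplace_max Omega in
  let Lred := laplace_red Omega in
  (sobolev0 Omega 2 `<=` H_Delta Omega /\ op_linear L0 /\ op_linear L) /\
  (op_densely_defined L0 /\ op_closed L0) /\
  op_graph (op_adjoint L0) = op_graph L /\
  (closed (op_range L0) /\ closed (op_range L)) /\
  (op_ker L0 = [set 0] /\ op_range L0 = Hperp /\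
   op_ker L = L2_harmonic Omega /\ op_range L = setT) /\
  (set_bij (sobolev0 Omega 2) Hperp L0 /\ op_bounded (op_inv L0)) /\
  (set_bij (H_Delta Omega `&` Hperp) setT Lred /\ op_bounded (op_inv Lred)) /\
  (op_norm (op_inv L0) = op_norm (op_inv Lred) /\
   op_norm (op_inv Lred) <= c_f ^+ 2) /\
  (forall phi, sobolev0 Omega 2 phi \/ (H_Delta Omega `&` Hperp) phi ->
     `|phi| <= c_f ^+ 2 * `|laplacian phi|) /\
  (forall f, Hperp f ->
     exists! u, sobolev0 Omega 2 u /\ - laplacian u = f) /\
  (forall f : L2 Omega,
     exists! u, (H_Delta Omega u /\ Hperp u) /\ - laplacian u = f).
Proof.
move=> c_f Hperp L0 L Lred.
have [b1 b2 n1 n2] := inv_norms hOmega.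
have rL : op_range L = setT.
  by apply/seteqP; split=> // f _; have [w [dw _ e]] := red_surj hOmega f; exists w.
split; [|split; [|split; [|split; [|split; [|split; [|split; [|split; [|split; [|split]]]]]]]]].
- split; last by split; [exact: laplace_min_linear|exact: laplace_max_linear].
  by move=> u /sobolev0_graph/lap_graph_laplacian h; exists (laplacian u).
- by split; [exact: laplace_min_dense|exact: laplace_min_closed].
- exact: adjoint_graph.
- split; first by apply: closed_L2; exact: range_min_closed.
  by rewrite rL; exact: closedT.
- split; [|split; [exact: range_min|split; [exact: ker_max|exact: rL]]].
  have lin := laplace_min_linear hOmega.
  apply/seteqP; split=> [u [du e]|_ ->]; last by split; [exact: lin.1|exact: op_linear0].
  apply: (op_injE (laplace_min_inj hOmega) du lin.1).
  exact: etrans e (esym (op_linear0 lin)).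
- split=> //; split.
  + by move=> u du; rewrite /Hperp -(range_min hOmega); exists u.
  + exact: laplace_min_inj.
  + by move=> f; rewrite /Hperp -(range_min hOmega).
- split=> //; split=> //; first exact: (@red_inj _ _ Omega).
  by move=> f _; have [w [dw pw e]] := red_surj hOmega f; exists w.
- by [].
- move=> u [du|[du pu]].
    by have := laplace_min_bound hOmega du; rewrite normrN.
  have := red_bound hOmega du pu (sqr_ge0 c_f) (inv_min_bounded hOmega).
  by rewrite normrN.
- move=> f; rewrite /Hperp -(range_min hOmega) => -[u du e]; exists u.
  split; [by split|move=> v [dv e']].
  exact: (op_injE (laplace_min_inj hOmega) du dv (etrans e (esym e'))).
- move=> f; have [w [dw pw e]] := red_surj hOmega f; exists w.
  split; [by split|move=> v [dv e']].
  exact: (op_injE (@red_inj _ _ Omega) (conj dw pw) dv (etrans e (esym e'))).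
Qed.
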